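(* Let $\vec a=(n_1,\dots,n_s)$ be a sequence of positive integers with $n_{i+1}\mid n_i$ for $1\le i\le s-1$, let $m\ge1$, and let $n=n_1\cdots n_s m$. Let $F_{\vec a,m}=H_{n_1}\times\cdots\times H_{n_s}\times T_m\subset G=\mathrm{PU}(n)$, and let $W(F_{\vec a,m})=N_G(F_{\vec a,m})/C_G(F_{\vec a,m})$. Then $$W(F_{\vec a,m})=\mathrm{Hom}\bigl(V_{\vec a},\mathrm U(1)^m/\mathrm Z_m\bigr)\rtimes\bigl(S_m\times\mathrm{Sp}(V_{\vec a})\bigr).$$
   Context: $\mathrm{PU}(n)=\mathrm U(n)/\mathrm Z_n$, $\mathrm Z_n=\{\lambda I_n:|\lambda|=1\}$; $[A]$ is the class of $A$. For $k\ge1$ put $\omega_k=e^{2\pi i/k}$ and let $H_k\subset \mathrm{PU}(k)$ be generated by $[\mathrm{diag}\{1,\omega_k,\dots,\omega_k^{k-1}\}]$ and the class of the cyclic permutation matrix with entries $1$ in positions $(i,i+1)$, $1\le i\le k-1$, and $(k,1)$. On $H_k$ there is an antisymmetric bimultiplicative function $b_k:H_k\times H_k\to\mathrm U(1)$ defined by $ABA^{-1}B^{-1}=b_k([A],[B])I$. $V_{\vec a}=H_{n_1}\times\cdots\times H_{n_s}$ is equipped with the antisymmetric bimultiplicative function that restricts to $b_{n_i}$ on each $H_{n_i}$ and for which $H_{n_i},H_{n_j}$ are orthogonal for $i\ne j$; $\mathrm{Sp}(V_{\vec a})$ is the group of automorphisms of the abelian group $V_{\vec a}$ preserving this function. $T_m$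 is the maximal torus of $\mathrm{PU}(m)$ consisting of classes of diagonal matrices, identified with $\mathrm U(1)^m/\mathrm Z_m$. $F_{\vec a,m}$ is the image of $H_{n_1}\times\cdots\times H_{n_s}\times T_m$ in $\mathrm{PU}(n)$ under $([A_1],\dots,[A_s],[B])\mapsto[A_1\otimes\cdots\otimes A_s\otimes B]$. $S_m$ is the symmetric group, acting on $\mathrm U(1)^m/\mathrm Z_m$ by permuting coordinates; $S_m\times\mathrm{Sp}(V_{\vec a})$ acts on $\mathrm{Hom}(V_{\vec a},\mathrm U(1)^m/\mathrm Z_m)$ by $(\sigma,g)\cdot\varphi=\sigma\circ\varphi\circ g^{-1}$, and ''$=$'' means isomorphism of groups. *)

(* Defs.v *)
From HB Require Import structures.
From mathcomp Require Import all_boot all_order all_fingroup all_algebra.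
From mathcomp Require Import spectral complex mxtens.
From mathcomp Require Import boolp classical_sets reals topology trigo.
From mathcomp Require Import generic_quotient.

Set Implicit Arguments.
Unset Strict Implicit.
Unset Printing Implicit Defensive.

Import Order.TTheory GRing.Theory Num.Theory.
Local Open Scope quotient_scope.
Local Open Scope classical_set_scope.
Local Open Scope group_scope.

Definition isomorphic (G H : groupType) : Prop :=
  exists f : {multiplicative G -> H}, bijective f.

Section SubgroupType.
Variables (G : groupType) (P : groupClosed G).

Record subg_of := SubgOf { subg_val : G; _ : subg_val \in P }.

HB.instance Definition _ := [isSub for subg_val].
HB.instance Definition _ := [Choice of subg_of by <:].

Fact subg_of_closed : group_closed (fun x : G => x \in P).
Proof.
split=> [|x y xP yP]; first exact: gpred1.
exact: (@gpredF G P x y xP yP).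
Qed.

HB.instance Definition _ :=
  SubChoice_isSubGroup.Build G (fun x => x \in P) subg_of subg_of_closed.

End SubgroupType.

Section Generated.
Variables (G : groupType) (A : set G).

Definition generated : {pred G} :=
  [pred x | `[< forall K : groupClosed G,
                  (forall y, A y -> y \in K) -> x \in K >]].

Fact generated_mul : mulg_closed generated.
Proof.
move=> x y /asboolP xA /asboolP yA; apply/asboolP => K AK.
by rewrite gpredM ?xA ?yA.
Qed.
Fact generated_one : 1 \in generated.
Proof. by apply/asboolP => K AK; exact: gpred1. Qed.
Fact generated_inv : invg_closed generated.
Proof. by move=> x /asboolP xA; apply/asboolP => K AK; rewrite gpredV xA. Qed.

HB.instance Definition _ := isMulClosed.Build G generated generated_mul.
HB.instance Definition _ := isMul1Closed.Build G generated generated_one.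
HB.instance Definition _ := isInvClosed.Build G generated generated_inv.

End Generated.

HB.mixin Record isConjClosed (G : groupType) (S : {pred G}) := {
  gpred_conj : forall x y, x \in S -> x ^ y \in S
}.

#[short(type="normalClosed")]
HB.structure Definition NormalClosed (G : groupType) :=
  {S of GroupClosed G S & isConjClosed G S}.

Section Quotient.
Variables (G : groupType) (N : normalClosed G).

Definition coset_rel (x y : G) : bool := x^-1 * y \in N.

Fact coset_rel_refl : reflexive coset_rel.
Proof. by move=> x; rewrite /coset_rel mulVg gpred1. Qed.
Fact coset_rel_sym : symmetric coset_rel.
Proof. by move=> x y; rewrite /coset_rel -gpredV invgM invgK. Qed.
Fact coset_rel_trans : transitive coset_rel.
Proof.
move=> y x z; rewrite /coset_rel => xy yz.
have -> : x^-1 * z = (x^-1 * y) * (y^-1 * z) by rewrite mulgA mulgK.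
by rewrite gpredM.
Qed.

Canonical coset_equiv := EquivRel coset_rel
  coset_rel_refl coset_rel_sym coset_rel_trans.

Definition quotg := {eq_quot coset_rel}.
HB.instance Definition _ := Choice.on quotg.
HB.instance Definition _ := EqQuotient.on quotg.

Definition quotg_one : quotg := \pi_quotg 1.
Definition quotg_mul (x y : quotg) : quotg := \pi_quotg (repr x * repr y).
Definition quotg_inv (x : quotg) : quotg := \pi_quotg (repr x)^-1.

Lemma eq_quotgP (x y : G) :
  reflect (\pi_quotg x = \pi_quotg y) (x^-1 * y \in N).
Proof.
have := @eqmodP G coset_equiv x y; rewrite /= /coset_rel => e.
by apply: (iffP idP) => /e.
Qed.

Lemma quotg_mulE (x y : G) :
  quotg_mul (\pi_quotg x) (\pi_quotg y) = \pi_quotg (x * y).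
Proof.
apply/eq_quotgP; set x' := repr _; set y' := repr _.
have /eq_quotgP xx' : \pi_quotg x' = \pi_quotg x by rewrite reprK.
have /eq_quotgP yy' : \pi_quotg y' = \pi_quotg y by rewrite reprK.
have -> : (x' * y')^-1 * (x * y) = (x'^-1 * x) ^ y' * (y'^-1 * y).
  by rewrite /conjg invgM !mulgA mulgK.
by rewrite gpredM ?gpred_conj.
Qed.

Lemma quotg_invE (x : G) : quotg_inv (\pi_quotg x) = \pi_quotg x^-1.
Proof.
apply/eq_quotgP; set x' := repr _.
have /eq_quotgP xx' : \pi_quotg x = \pi_quotg x' by rewrite reprK.
have -> : x'^-1^-1 * x^-1 = (x^-1 * x') ^ x^-1.
  by rewrite /conjg !invgK !mulgA mulgV mul1g.
by rewrite gpred_conj.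
Qed.

Lemma quotg_surj (x : quotg) : exists a : G, x = \pi_quotg a.
Proof. by exists (repr x); rewrite reprK. Qed.

Fact quotg_mulA : associative quotg_mul.
Proof.
move=> x y z; case: (quotg_surj x) (quotg_surj y) (quotg_surj z).
by move=> a -> [b ->] [c ->]; rewrite !quotg_mulE mulgA.
Qed.
Fact quotg_mul1 : left_id quotg_one quotg_mul.
Proof. by move=> x; case: (quotg_surj x) => a ->; rewrite quotg_mulE mul1g. Qed.
Fact quotg_mulr1 : right_id quotg_one quotg_mul.
Proof. by move=> x; case: (quotg_surj x) => a ->; rewrite quotg_mulE mulg1. Qed.
Fact quotg_mulV : left_inverse quotg_one quotg_inv quotg_mul.
Proof.
move=> x; case: (quotg_surj x) => a ->.
by rewrite quotg_invE quotg_mulE mulVg.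
Qed.
Fact quotg_mulrV : right_inverse quotg_one quotg_inv quotg_mul.
Proof.
move=> x; case: (quotg_surj x) => a ->.
by rewrite quotg_invE quotg_mulE mulgV.
Qed.

HB.instance Definition _ := isGroup.Build quotg
  quotg_mulA quotg_mul1 quotg_mulr1 quotg_mulV quotg_mulrV.

Lemma quotgM (x y : G) : \pi_quotg (x * y) = \pi_quotg x * \pi_quotg y.
Proof. by rewrite -quotg_mulE. Qed.

Lemma quotgV (x : G) : \pi_quotg x^-1 = (\pi_quotg x)^-1.
Proof. by rewrite -quotg_invE. Qed.

End Quotient.

Section Centraliser.
Variables (G : groupType) (F : set G).

Definition centraliser : {pred G} :=
  [pred g | `[< forall x, F x -> commute g x >]].

Fact centraliser_mul : mulg_closed centraliser.
Proof.
move=> g h /asboolP gF /asboolP hF; apply/asboolP => x Fx.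
by apply/commute_sym/commuteM; apply/commute_sym; [apply: gF|apply: hF].
Qed.
Fact centraliser_one : 1 \in centraliser.
Proof. by apply/asboolP => x Fx; exact/commute_sym/commute1. Qed.
Fact centraliser_inv : invg_closed centraliser.
Proof.
move=> g /asboolP gF; apply/asboolP => x Fx.
by apply/commute_sym/commuteV/commute_sym/gF.
Qed.
HB.instance Definition _ := isMulClosed.Build G centraliser centraliser_mul.
HB.instance Definition _ := isMul1Closed.Build G centraliser centraliser_one.
HB.instance Definition _ := isInvClosed.Build G centraliser centraliser_inv.

End Centraliser.

Section Weyl.
Variables (G : groupType) (F : set G).

Definition normaliser : {pred G} :=
  [pred g | `[< forall x, F x <-> F (x ^ g) >]].

Fact normaliser_mul : mulg_closed normaliser.
Proof.
move=> g h /asboolP gF /asboolP hF; apply/asboolP => x.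
by rewrite conjgM -hF -gF.
Qed.
Fact normaliser_one : 1 \in normaliser.
Proof. by apply/asboolP => x; rewrite conjg1. Qed.
Fact normaliser_inv : invg_closed normaliser.
Proof.
by move=> g /asboolP gF; apply/asboolP => x; rewrite (gF (x ^ g^-1)) conjgKV.
Qed.
HB.instance Definition _ := isMulClosed.Build G normaliser normaliser_mul.
HB.instance Definition _ := isMul1Closed.Build G normaliser normaliser_one.
HB.instance Definition _ := isInvClosed.Build G normaliser normaliser_inv.

(* C_G(F), which is contained in N_G(F), as a subgroup of N_G(F) *)
Definition centraliser_in : {pred subg_of normaliser} :=
  [pred g | subg_val g \in centraliser F].

Fact centraliser_in_mul : mulg_closed centraliser_in.
Proof. by move=> g h; apply: gpredM. Qed.
Fact centraliser_in_one : 1 \in centraliser_in.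
Proof. exact: gpred1. Qed.
Fact centraliser_in_inv : invg_closed centraliser_in.
Proof. by move=> g; apply: gpredVr. Qed.
Fact centraliser_in_conj g h : g \in centraliser_in -> g ^ h \in centraliser_in.
Proof.
move=> /asboolP gF; apply/asboolP => x Fx.
have Fy : F (x ^ (subg_val h)^-1).
  have /asboolP/(_ (x ^ (subg_val h)^-1)) := valP h.
  by rewrite conjgKV => ->.
have := congr1 (fun z => z ^ subg_val h) (gF _ Fy).
by rewrite /= (conjMg (subg_val g)) (conjMg _ (subg_val g)) conjgKV.
Qed.
HB.instance Definition _ := isMulClosed.Build _ centraliser_in centraliser_in_mul.
HB.instance Definition _ := isMul1Closed.Build _ centraliser_in centraliser_in_one.
HB.instance Definition _ := isInvClosed.Build _ centraliser_in centraliser_in_inv.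
HB.instance Definition _ := isConjClosed.Build _ centraliser_in centraliser_in_conj.

Definition weyl : groupType := quotg centraliser_in.

End Weyl.

HB.mixin Record Group_isCommutative G of monoid.Group G := {
  mulgC : commutative (@monoid.mul G)
}.

#[short(type="comGroupType")]
HB.structure Definition ComGroup := {G of monoid.Group G & Group_isCommutative G}.

Section HomGroup.
Variables (G : groupType) (T : comGroupType).

Definition group_hom := {multiplicative G -> T}.
HB.instance Definition _ := gen_eqMixin group_hom.
HB.instance Definition _ := gen_choiceMixin group_hom.
Identity Coercion multiplicative_of_group_hom : group_hom >-> Multiplicative.type.

Lemma homP (f g : group_hom) : f =1 g -> f = g.
Proof.
case: f g => [f [[fM]]] [g [[gM]]] /= /funext fg.
by case: _ / fg gM => gM; rewrite (Prop_irrelevance fM gM).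
Qed.

Fact hom_one_morph : {morph (fun=> 1 : T) : x y / x * y : G >-> x * y}.
Proof. by move=> x y; rewrite mulg1. Qed.
Fact hom_mul_morph (f g : group_hom) : {morph (fun x => f x * g x) : x y / x * y}.
Proof.
move=> x y; rewrite !gmulfM !mulgA; congr (_ * _).
by rewrite -!mulgA; congr (_ * _); exact: mulgC.
Qed.
Fact hom_inv_morph (f : group_hom) : {morph (fun x => (f x)^-1) : x y / x * y}.
Proof. by move=> x y; rewrite gmulfM invgM mulgC. Qed.

Definition hom_one : group_hom := HB.pack (fun=> 1 : T)
  (isMultiplicative.Build G T (fun=> 1) hom_one_morph).
Definition hom_mul (f g : group_hom) : group_hom := HB.pack (fun x => f x * g x)
  (isMultiplicative.Build G T (fun x => f x * g x) (hom_mul_morph f g)).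
Definition hom_inv (f : group_hom) : group_hom := HB.pack (fun x => (f x)^-1)
  (isMultiplicative.Build G T (fun x => (f x)^-1) (hom_inv_morph f)).

Fact hom_mulA : associative hom_mul.
Proof. by move=> f g h; apply: homP => x /=; rewrite mulgA. Qed.
Fact hom_mul1 : left_id hom_one hom_mul.
Proof. by move=> f; apply: homP => x /=; rewrite mul1g. Qed.
Fact hom_mulr1 : right_id hom_one hom_mul.
Proof. by move=> f; apply: homP => x /=; rewrite mulg1. Qed.
Fact hom_mulV : left_inverse hom_one hom_inv hom_mul.
Proof. by move=> f; apply: homP => x /=; rewrite mulVg. Qed.
Fact hom_mulrV : right_inverse hom_one hom_inv hom_mul.
Proof. by move=> f; apply: homP => x /=; rewrite mulgV. Qed.
HB.instance Definition _ := isGroup.Build group_hom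
  hom_mulA hom_mul1 hom_mulr1 hom_mulV hom_mulrV.

End HomGroup.

Section FormAutomorphisms.
Variables (V : groupType) (T : Type) (b : V -> V -> T).

(* The inverse is recorded for convenience; it is determined by faut. *)
Record form_aut := FormAut {
  faut : V -> V;
  faut_inv : V -> V;
  fautK : cancel faut faut_inv;
  faut_invK : cancel faut_inv faut;
  fautM : {morph faut : x y / x * y};
  faut_form : forall x y, b (faut x) (faut y) = b x y
}.

HB.instance Definition _ := gen_eqMixin form_aut.
HB.instance Definition _ := gen_choiceMixin form_aut.

Lemma form_autP (f g : form_aut) : faut f =1 faut g -> f = g.
Proof.
case: f g => [f f' fK f'K fM fb] [g g' gK g'K gM gb] /= fg.
have fg' : f' = g' by apply/funext => x; rewrite -{1}(g'K x) -fg fK.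
move/funext: fg => fg; subst g g'.
by congr FormAut; exact: Prop_irrelevance.
Qed.

Definition faut1 : form_aut := @FormAut id id
  (fun=> erefl) (fun=> erefl) (fun _ _ => erefl) (fun _ _ => erefl).

Fact faut_mul_morph (f g : form_aut) :
  {morph (faut f \o faut g) : x y / x * y}.
Proof. by move=> x y; rewrite /= !fautM. Qed.
Fact faut_mul_form (f g : form_aut) x y :
  b ((faut f \o faut g) x) ((faut f \o faut g) y) = b x y.
Proof. by rewrite /= !faut_form. Qed.
Definition faut_mul (f g : form_aut) : form_aut :=
  FormAut (can_comp (fautK f) (fautK g)) (can_comp (faut_invK g) (faut_invK f))
    (@faut_mul_morph f g) (@faut_mul_form f g).

Fact faut_inv_morph (f : form_aut) : {morph faut_inv f : x y / x * y}.
Proof.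
move=> x y; apply: (can_inj (fautK f)).
by rewrite fautM !faut_invK.
Qed.
Fact faut_inv_form (f : form_aut) x y :
  b (faut_inv f x) (faut_inv f y) = b x y.
Proof. by rewrite -(faut_form f) !faut_invK. Qed.
Definition faut_opp (f : form_aut) : form_aut :=
  FormAut (faut_invK f) (fautK f) (@faut_inv_morph f) (@faut_inv_form f).

Fact faut_mulA : associative faut_mul.
Proof. by move=> f g h; apply: form_autP. Qed.
Fact faut_mul1 : left_id faut1 faut_mul.
Proof. by move=> f; apply: form_autP. Qed.
Fact faut_mulr1 : right_id faut1 faut_mul.
Proof. by move=> f; apply: form_autP. Qed.
Fact faut_mulV : left_inverse faut1 faut_opp faut_mul.
Proof. by move=> f; apply: form_autP => x /=; rewrite fautK. Qed.
Fact faut_mulrV : right_inverse faut1 faut_opp faut_mul.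
Proof. by move=> f; apply: form_autP => x /=; rewrite faut_invK. Qed.
HB.instance Definition _ := isGroup.Build form_aut
  faut_mulA faut_mul1 faut_mulr1 faut_mulV faut_mulrV.

End FormAutomorphisms.

Record gaction (K N : groupType) := GAction {
  gact :> K -> N -> N;
  gact1 : forall n, gact 1 n = n;
  gactM : forall h k n, gact (h * k) n = gact h (gact k n);
  gact_morph : forall h, {morph gact h : n p / n * p}
}.

Section Semidirect.
Variables K N : groupType.

Definition semidirect (_ : gaction K N) := (N * K)%type.

Variable act : gaction K N.
Local Notation sd := (semidirect act).
HB.instance Definition _ := Choice.on sd.

Definition sd_one : sd := (1, 1).
Definition sd_mul (u v : sd) : sd :=
  (u.1 * act u.2 v.1, u.2 * v.2).
Definition sd_inv (u : sd) : sd :=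
  (act u.2^-1 u.1^-1, u.2^-1).

Lemma gact_one k : act k 1 = 1.
Proof. by apply: (mulgI (act k 1)); rewrite -gact_morph !mulg1. Qed.

Fact sd_mulA : associative sd_mul.
Proof.
move=> [n1 k1] [n2 k2] [n3 k3]; rewrite /sd_mul /=.
by rewrite gact_morph gactM !mulgA.
Qed.
Fact sd_mul1 : left_id sd_one sd_mul.
Proof. by move=> [n k]; rewrite /sd_mul /= gact1 !mul1g. Qed.
Fact sd_mulr1 : right_id sd_one sd_mul.
Proof. by move=> [n k]; rewrite /sd_mul /= gact_one !mulg1. Qed.
Fact sd_mulV : left_inverse sd_one sd_inv sd_mul.
Proof.
by move=> [n k]; rewrite /sd_mul /sd_inv /= -gact_morph !mulVg gact_one.
Qed.
Fact sd_mulrV : right_inverse sd_one sd_inv sd_mul.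
Proof.
by move=> [n k]; rewrite /sd_mul /sd_inv /= -gactM !mulgV gact1 mulgV.
Qed.
HB.instance Definition _ := isGroup.Build sd
  sd_mulA sd_mul1 sd_mulr1 sd_mulV sd_mulrV.

End Semidirect.

Fact unit_mulA : associative (fun _ _ : unit => tt). Proof. by []. Qed.
Fact unit_mul1 : left_id tt (fun _ _ : unit => tt). Proof. by case. Qed.
Fact unit_mulr1 : right_id tt (fun _ _ : unit => tt). Proof. by case. Qed.
Fact unit_mulV : left_inverse tt (fun=> tt) (fun _ _ : unit => tt).
Proof. by []. Qed.
Fact unit_mulrV : right_inverse tt (fun=> tt) (fun _ _ : unit => tt).
Proof. by []. Qed.
HB.instance Definition _ := isGroup.Build unit
  unit_mulA unit_mul1 unit_mulr1 unit_mulV unit_mulrV.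

Section Unitary.
Variable R : realType.
Local Notation C := R[i].
Local Open Scope ring_scope.

Record circle := Circle { circle_val : C; _ : `|circle_val| == 1 }.
HB.instance Definition _ := [isSub for circle_val].
HB.instance Definition _ := [Choice of circle by <:].

Lemma circle_norm (z : circle) : `|circle_val z| = 1.
Proof. by apply/eqP; case: z. Qed.

Fact circle_one_proof : `|1 : C| == 1. Proof. by rewrite normr1. Qed.
Fact circle_mul_proof (z w : circle) : `|circle_val z * circle_val w| == 1.
Proof. by rewrite normrM !circle_norm mulr1. Qed.
Fact circle_inv_proof (z : circle) : `|(circle_val z)^-1| == 1.
Proof. by rewrite normfV circle_norm invr1. Qed.

Definition circle_one := Circle circle_one_proof.
Definition circle_mul z w := Circle (circle_mul_proof z w).
Definition circle_inv z := Circle (circle_inv_proof z).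

Lemma circle_neq0 (z : circle) : circle_val z != 0.
Proof. by rewrite -normr_eq0 circle_norm oner_eq0. Qed.

Fact circle_mulA : associative circle_mul.
Proof. by move=> x y z; apply/val_inj; rewrite /= mulrA. Qed.
Fact circle_mul1 : left_id circle_one circle_mul.
Proof. by move=> x; apply/val_inj; rewrite /= mul1r. Qed.
Fact circle_mulr1 : right_id circle_one circle_mul.
Proof. by move=> x; apply/val_inj; rewrite /= mulr1. Qed.
Fact circle_mulV : left_inverse circle_one circle_inv circle_mul.
Proof. by move=> x; apply/val_inj; rewrite /= mulVf ?circle_neq0. Qed.
Fact circle_mulrV : right_inverse circle_one circle_inv circle_mul.
Proof. by move=> x; apply/val_inj; rewrite /= mulfV ?circle_neq0. Qed.
HB.instance Definition _ := isGroup.Build circle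
  circle_mulA circle_mul1 circle_mulr1 circle_mulV circle_mulrV.

Fact circle_mulC : commutative (@monoid.mul circle).
Proof. by move=> x y; apply/val_inj; rewrite /= mulrC. Qed.
HB.instance Definition _ := Group_isCommutative.Build circle circle_mulC.

Section UnitaryGroup.
Variable n : nat.

Record unitary := Unitary { umx : 'M[C]_n; _ : umx \is unitarymx }.
HB.instance Definition _ := [isSub for umx].
HB.instance Definition _ := [Choice of unitary by <:].

Lemma umxP (A : unitary) : umx A \is unitarymx. Proof. by case: A. Qed.

Fact unitary_one_proof : (1%:M : 'M[C]_n) \is unitarymx.
Proof. by apply/unitarymxP; rewrite trmx1 map_mx1 mulmx1. Qed.
Fact unitary_inv_proof (A : unitary) : invmx (umx A) \is unitarymx.
Proof. by rewrite invmx_unitary ?trmxC_unitary umxP. Qed.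

Definition unitary_one := Unitary unitary_one_proof.
Definition unitary_mul (A B : unitary) :=
  Unitary (mul_unitarymx (umxP A) (umxP B)).
Definition unitary_inv (A : unitary) := Unitary (unitary_inv_proof A).

Fact unitary_mulA : associative unitary_mul.
Proof. by move=> A B D; apply/val_inj; rewrite /= mulmxA. Qed.
Fact unitary_mul1 : left_id unitary_one unitary_mul.
Proof. by move=> A; apply/val_inj; rewrite /= mul1mx. Qed.
Fact unitary_mulr1 : right_id unitary_one unitary_mul.
Proof. by move=> A; apply/val_inj; rewrite /= mulmx1. Qed.
Fact unitary_mulV : left_inverse unitary_one unitary_inv unitary_mul.
Proof.
by move=> A; apply/val_inj; rewrite /= mulVmx // unitarymx_unit ?umxP.
Qed.
Fact unitary_mulrV : right_inverse unitary_one unitary_inv unitary_mul.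
Proof.
by move=> A; apply/val_inj; rewrite /= mulmxV // unitarymx_unit ?umxP.
Qed.
HB.instance Definition _ := isGroup.Build unitary
  unitary_mulA unitary_mul1 unitary_mulr1 unitary_mulV unitary_mulrV.

Fact scalar_unitary_proof (z : circle) :
  (circle_val z)%:M \is @unitarymx C n n.
Proof.
apply/unitarymxP; rewrite tr_scalar_mx map_scalar_mx -scalar_mxM.
by rewrite -normCK circle_norm expr1n.
Qed.
Definition scalar_unitary (z : circle) : unitary :=
  Unitary (scalar_unitary_proof z).

Definition scalars : {pred unitary} :=
  [pred A | `[< exists z, A = scalar_unitary z >]].

Lemma scalar_unitaryM (z w : circle) :
  (scalar_unitary (z * w) = scalar_unitary z * scalar_unitary w)%g.
Proof. by apply/val_inj; rewrite /= scalar_mxM. Qed.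

Lemma scalar_unitary1 : scalar_unitary 1%g = 1%g.
Proof. exact/val_inj. Qed.

Lemma scalar_unitaryC (z : circle) (A : unitary) :
  commute (scalar_unitary z) A.
Proof. by apply/val_inj; rewrite /= scalar_mxC. Qed.

Fact scalars_mul : mulg_closed scalars.
Proof.
move=> A B /asboolP[z ->] /asboolP[w ->]; apply/asboolP.
by exists (z * w)%g; rewrite scalar_unitaryM.
Qed.
Fact scalars_one : 1%g \in scalars.
Proof. by apply/asboolP; exists 1%g; rewrite scalar_unitary1. Qed.
Fact scalars_inv : invg_closed scalars.
Proof.
move=> A /asboolP[z ->]; apply/asboolP; exists z^-1%g.
apply: (@mulgI _ (scalar_unitary z)).
by rewrite -scalar_unitaryM !mulgV scalar_unitary1.
Qed.
Fact scalars_conj (A B : unitary) : A \in scalars -> (A ^ B)%g \in scalars.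
Proof.
move=> /asboolP[z ->]; apply/asboolP; exists z.
by rewrite conjgE scalar_unitaryC mulKg.
Qed.
HB.instance Definition _ := isMulClosed.Build unitary scalars scalars_mul.
HB.instance Definition _ := isMul1Closed.Build unitary scalars scalars_one.
HB.instance Definition _ := isInvClosed.Build unitary scalars scalars_inv.
HB.instance Definition _ := isConjClosed.Build unitary scalars scalars_conj.

Definition PU : groupType := quotg scalars.
Definition PUclass (A : unitary) : PU := \pi_(quotg scalars) A.

Lemma PUclassM (A B : unitary) : PUclass (A * B)%g = (PUclass A * PUclass B)%g.
Proof. exact: quotgM. Qed.

Lemma PUclass_surj (x : PU) : exists A, x = PUclass A.
Proof. exact: quotg_surj. Qed.

Definition maximal_torus : set PU :=
  [set x | exists2 A : unitary, is_diag_mx (umx A) & x = PUclass A].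

End UnitaryGroup.

Lemma tensmx_unitary p q (A : 'M[C]_p) (B : 'M[C]_q) :
  A \is unitarymx -> B \is unitarymx -> A *t B \is unitarymx.
Proof.
move=> /unitarymxP AA /unitarymxP BB; apply/unitarymxP.
rewrite trmx_tens map_mxT tensmx_mul AA BB.
apply/matrixP => i j; case: (mxtens_indexP i) => i1 i2.
case: (mxtens_indexP j) => j1 j2; rewrite tensmxE !mxE -natrM mulnb.
by rewrite (can_eq (@mxtens_indexK p q)) xpair_eqE.
Qed.

Definition unitary_tens p q (A : unitary p) (B : unitary q) : unitary (p * q) :=
  Unitary (tensmx_unitary (umxP A) (umxP B)).

(* independent of the representatives, see PU_tensE *)
Definition PU_tens p q (x : PU p) (y : PU q) : PU (p * q) :=
  PUclass (unitary_tens (repr x) (repr y)).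

Lemma PUclassP n (A B : unitary n) :
  PUclass A = PUclass B <-> exists z, B = (A * scalar_unitary n z)%g.
Proof.
split=> [/eq_quotgP/asboolP[z AB]|[z ->]].
  by exists z; rewrite -AB mulVKg.
by apply/eq_quotgP/asboolP; exists z; rewrite mulKg.
Qed.

Lemma PU_tensE p q (A : unitary p) (B : unitary q) :
  PU_tens (PUclass A) (PUclass B) = PUclass (unitary_tens A B).
Proof.
rewrite /PU_tens.
have /PUclassP[z Az] : PUclass A = PUclass (repr (PUclass A)).
  by rewrite /PUclass reprK.
have /PUclassP[w Bw] : PUclass B = PUclass (repr (PUclass B)).
  by rewrite /PUclass reprK.
rewrite Az Bw; apply/esym/PUclassP; exists (z * w)%g; apply/val_inj => /=.
rewrite !mul_mx_scalar; apply/matrixP => i j; rewrite !mxE.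
by rewrite -!mulrA; congr (_ * _); rewrite mulrCA.
Qed.

Definition omega (k : nat) : C :=
  (cos (2 * trigo.pi / k%:R) +i* sin (2 * trigo.pi / k%:R))%C.

Definition clock_mx (k : nat) : 'M[C]_k := diag_mx (\row_i omega k ^+ i).

(* ordS i is the successor of i modulo k *)
Definition shift_mx (k : nat) : 'M[C]_k := \matrix_(i, j) (j == ordS i)%:R.

Lemma norm_omega k : `|omega k| = 1.
Proof. by rewrite normc_def /= cos2Dsin2 sqrtr1. Qed.

Fact clock_unitary_proof k : clock_mx k \is unitarymx.
Proof.
apply/unitarymxP; rewrite tr_diag_mx map_diag_mx mulmx_diag.
apply/matrixP => i j; rewrite !mxE -normCK normrX norm_omega !expr1n.
by [].
Qed.
Definition clock k : unitary k := Unitary (clock_unitary_proof k).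

Fact shift_unitary_proof k : shift_mx k \is unitarymx.
Proof.
apply/unitarymxP/matrixP => i j; rewrite !mxE (bigD1 (ordS i)) //= !mxE eqxx.
rewrite mul1r big1 ?addr0 => [|l /negPf li]; last by rewrite !mxE li mul0r.
by rewrite conjC_nat (can_eq (@ordSK k)).
Qed.
Definition shift k : unitary k := Unitary (shift_unitary_proof k).

Definition clock_shift (k : nat) : set (PU k) :=
  [set x | x = PUclass (clock k) \/ x = PUclass (shift k)].

Definition Hk (k : nat) : groupType := subg_of (generated (@clock_shift k)).

(* the unique (for k > 0) z with A B A^-1 B^-1 = z I; it exists by HformE *)
Definition Hform (k : nat) (x y : Hk k) : circle :=
  xget 1%g [set z | forall A B : unitary k,
    PUclass A = subg_val x -> PUclass B = subg_val y ->
    (A * B * A^-1 * B^-1)%g = scalar_unitary k z].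

Lemma omegaX k n : omega k ^+ n =
  (cos (2 * trigo.pi / k%:R *+ n) +i* sin (2 * trigo.pi / k%:R *+ n))%C.
Proof.
rewrite /omega; move: (2 * trigo.pi / k%:R) => t.
elim: n => [|n IH]; first by rewrite expr0 !mulr0n cos0 sin0.
rewrite exprS IH !mulrS cosD sinD; apply/eqP; rewrite eq_complex /=.
by rewrite eqxx [X in _ == X]addrC eqxx.
Qed.

Lemma omega_prim k : (0 < k)%N -> omega k ^+ k = 1.
Proof.
move=> k0; rewrite omegaX -mulr_natr divfK ?pnatr_eq0 -?lt0n //.
by rewrite mulr_natl cos2pi sin2pi.
Qed.

Lemma clock_shift_mul k : (0 < k)%N ->
  clock_mx k *m shift_mx k *m (omega k)%:M = shift_mx k *m clock_mx k.
Proof.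
case: k => // k _; apply/matrixP => i j.
rewrite mul_mx_scalar mul_diag_mx mul_mx_diag !mxE.
have [-> | _] := eqVneq j (ordS i); last by rewrite mulr0n mul0r !mulr0.
rewrite mulr1n mulr1 mul1r -exprS /=.
have [ik|] := ltnP i.+1 k.+1; first by rewrite modn_small.
rewrite leq_eqVlt ltnNge ltn_ord orbF => /eqP <-.
by rewrite modnn expr0 omega_prim.
Qed.

Lemma clock_shiftC k : commute (PUclass (clock k)) (PUclass (shift k)).
Proof.
rewrite /commute -!PUclassM; apply/PUclassP.
case: (posnP k) => [k0|k0].
  by exists 1%g; apply/val_inj/matrixP => i; have := ltn_ord i; rewrite {2}k0.
have w1 : `|omega k| == 1 by rewrite norm_omega.
exists (Circle w1); apply/val_inj; exact/esym/clock_shift_mul.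
Qed.

Lemma Hk_comm k (x y : Hk k) : commute (subg_val x) (subg_val y).
Proof.
have cs z : clock_shift z -> z \in centraliser (@clock_shift k).
  move=> cz; apply/asboolP => w cw.
  by case: cz cw => -> [] ->; do ?[by []|exact: clock_shiftC
    |exact/commute_sym/clock_shiftC].
have /asboolP/(_ _ cs)/asboolP xcs := valP x.
have yx z : clock_shift z -> z \in centraliser [set subg_val x].
  by move=> cz; apply/asboolP => _ ->; exact/commute_sym/xcs.
have /asboolP/(_ _ yx)/asboolP yc := valP y.
exact/commute_sym/yc.
Qed.

Lemma HformE k (x y : Hk k) (A B : unitary k) :
  PUclass A = subg_val x -> PUclass B = subg_val y ->
  (A * B * A^-1 * B^-1)%g = scalar_unitary k (Hform x y).
Proof.
move: A B; apply: (@xgetPex _ 1%g [set z | forall A B : unitary k,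
    PUclass A = subg_val x -> PUclass B = subg_val y ->
    (A * B * A^-1 * B^-1)%g = scalar_unitary k z]).
case: (PUclass_surj (subg_val x)) (PUclass_surj (subg_val y)) => A xA [B yB].
have := Hk_comm x y; rewrite xA yB /commute -!PUclassM.
move=> /esym/PUclassP[z ABz]; exists z => A' B'.
move=> /esym/PUclassP[u ->] /esym/PUclassP[v ->].
have c w D D' : (D * scalar_unitary k w * D' = D * D' * scalar_unitary k w)%g.
  by rewrite -!mulgA scalar_unitaryC.
have gen (X Y Z : unitary k) :
    (X * Y = Z * (Y * X) -> X * Y * X^-1 * Y^-1 = Z)%g.
  by move=> ->; rewrite mulgA !mulgK.
apply: gen; rewrite [RHS]scalar_unitaryC !mulgA (c u A B) (c v B A) ABz -!mulgA.
congr (_ * (_ * _))%g; rewrite -!scalar_unitaryM; congr scalar_unitary.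
by rewrite mulgC (mulgC u) -mulgA.
Qed.

(* H_(n_1) * (H_(n_2) * ( ... * (H_(n_s) * 1))) for a = [:: n_1; ...; n_s] *)
Fixpoint Va (a : seq nat) : groupType :=
  if a is k :: a' then (Hk k * Va a')%type else unit.

Fixpoint Vform (a : seq nat) : Va a -> Va a -> circle :=
  if a is k :: a' then
    fun x y : Hk k * Va a' => (Hform x.1 y.1 * Vform x.2 y.2)%g
  else fun _ _ => 1%g.

Definition Sp (a : seq nat) : groupType := form_aut (@Vform a).

Fixpoint tdim (a : seq nat) (m : nat) : nat :=
  if a is k :: a' then (k * tdim a' m)%N else m.

Lemma tdimE (a : seq nat) (m : nat) : tdim a m = ((\prod_(k <- a) k) * m)%N.
Proof.
by elim: a => [|k a IH] /=; rewrite ?big_nil ?mul1n // big_cons IH mulnA.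
Qed.

(* ([A_1], ..., [A_s], [B]) |-> [A_1 (x) ... (x) A_s (x) B] *)
Fixpoint Va_tens (a : seq nat) (m : nat) : Va a -> PU m -> PU (tdim a m) :=
  if a is k :: a' then
    fun (v : Hk k * Va a') t => PU_tens (subg_val v.1) (Va_tens v.2 t)
  else fun _ t => t.

Definition Fam (a : seq nat) (m : nat) : set (PU (tdim a m)) :=
  [set x | exists (v : Va a) (t : PU m),
             maximal_torus t /\ x = Va_tens v t].

Section Torus.
Variable m : nat.

Definition circle_pow : groupType := {ffun 'I_m -> circle}.

Definition constants : {pred circle_pow} :=
  [pred f | `[< exists z : circle, f = [ffun=> z] >]].

Fact constants_mul : mulg_closed constants.
Proof.
move=> f g /asboolP[z ->] /asboolP[w ->]; apply/asboolP.
by exists (z * w)%g; apply/ffunP => i; rewrite !ffunE.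
Qed.
Fact constants_one : 1%g \in constants.
Proof. by apply/asboolP; exists 1%g. Qed.
Fact constants_inv : invg_closed constants.
Proof.
move=> f /asboolP[z ->]; apply/asboolP; exists z^-1%g.
by apply/ffunP => i; rewrite !ffunE.
Qed.
Fact constants_conj (f g : circle_pow) : f \in constants -> (f ^ g)%g \in constants.
Proof.
move=> /asboolP[z ->]; apply/asboolP; exists z.
by apply/ffunP => i; rewrite !ffunE (mulgC z) mulKg.
Qed.
HB.instance Definition _ := isMulClosed.Build circle_pow constants constants_mul.
HB.instance Definition _ := isMul1Closed.Build circle_pow constants constants_one.
HB.instance Definition _ := isInvClosed.Build circle_pow constants constants_inv.
HB.instance Definition _ :=
  isConjClosed.Build circle_pow constants constants_conj.

Definition torus := quotg constants.
HB.instance Definition _ := monoid.Group.on torus.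
Definition torus_class (f : circle_pow) : torus := \pi_(quotg constants) f.

Lemma torus_surj (x : torus) : exists f, x = torus_class f.
Proof. exact: quotg_surj. Qed.

Fact torus_mulC : commutative (@monoid.mul torus).
Proof.
move=> x y; case: (quotg_surj x) (quotg_surj y) => f -> [g ->].
rewrite -!quotgM; congr (\pi_(quotg constants) _).
by apply/ffunP => i; rewrite !ffunE mulgC.
Qed.
HB.instance Definition _ := Group_isCommutative.Build torus torus_mulC.

(* The product of permutations is (s * t) i = t (s i), so permuting the
   coordinates by z |-> (z_(s i))_i is a left action of 'S_m *)
Definition permute (s : 'S_m) (f : circle_pow) : circle_pow :=
  [ffun i => f (s i)].

Definition torus_perm (s : 'S_m) (t : torus) : torus :=
  torus_class (permute s (repr t)).

Lemma torus_permE (s : 'S_m) (f : circle_pow) :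
  torus_perm s (torus_class f) = torus_class (permute s f).
Proof.
apply/eq_quotgP; set f' := repr _.
have /eq_quotgP/asboolP[z ff'] : torus_class f' = torus_class f.
  by rewrite /torus_class reprK.
apply/asboolP; exists z; apply/ffunP => i.
by move/ffunP/(_ (s i)): ff'; rewrite !ffunE.
Qed.

Lemma torus_perm_morph (s : 'S_m) : {morph torus_perm s : x y / (x * y)%g}.
Proof.
move=> x y; case: (torus_surj x) (torus_surj y) => f -> [g ->].
rewrite -[LHS]/(torus_perm s (torus_class f * torus_class g)%g).
rewrite /torus_class -quotgM !torus_permE -quotgM; congr torus_class.
by apply/ffunP => i; rewrite !ffunE.
Qed.

Lemma torus_perm1 (x : torus) : torus_perm 1%g x = x.
Proof.
case: (torus_surj x) => f ->; rewrite torus_permE; congr torus_class.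
by apply/ffunP => i; rewrite ffunE perm1.
Qed.

Lemma torus_permM (s t : 'S_m) (x : torus) :
  torus_perm (s * t)%g x = torus_perm s (torus_perm t x).
Proof.
case: (torus_surj x) => f ->; rewrite !torus_permE; congr torus_class.
by apply/ffunP => i; rewrite !ffunE permM.
Qed.

End Torus.

Section Action.
Variables (a : seq nat) (m : nat).
Local Notation VHom := (group_hom (Va a) (torus m)).
Local Notation K := ('S_m * Sp a)%type.

Fact SSp_act_morph (u : K) (phi : VHom) :
  {morph (fun x => torus_perm u.1 (phi (faut u.2^-1%g x))) : x y / (x * y)%g}.
Proof. by move=> x y; rewrite fautM gmulfM torus_perm_morph. Qed.

Definition SSp_act_fun (u : K) (phi : VHom) : VHom :=
  HB.pack (fun x => torus_perm u.1 (phi (faut u.2^-1%g x)))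
    (isMultiplicative.Build _ _ _ (SSp_act_morph u phi)).

Fact SSp_act1 (phi : VHom) : SSp_act_fun 1%g phi = phi.
Proof. by apply: homP => x; rewrite /= torus_perm1. Qed.
Fact SSp_actM (u v : K) (phi : VHom) :
  SSp_act_fun (u * v)%g phi = SSp_act_fun u (SSp_act_fun v phi).
Proof. by apply: homP => x; rewrite /= torus_permM. Qed.
Fact SSp_act_mul (u : K) : {morph SSp_act_fun u : phi psi / (phi * psi)%g}.
Proof. by move=> phi psi; apply: homP => x; rewrite /= torus_perm_morph. Qed.

Definition SSp_act : gaction K VHom :=
  GAction SSp_act1 SSp_actM SSp_act_mul.

End Action.

End Unitary.

Arguments Fam : clear implicits.
Arguments SSp_act : clear implicits.

(* Main.v *)
From HB Require Import structures.
From mathcomp Require Import all_boot all_order all_fingroup all_algebra.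
From mathcomp Require Import spectral complex mxtens.
From mathcomp Require Import boolp classical_sets reals topology trigo.
From mathcomp Require Import generic_quotient.
Require Import Defs.

(** Write [V] for the abelian group [H_(n_1) x ... x H_(n_s)], [b] for its form, [T]
    for the torus [U(1)^m / Z_m], and [N = n_1 ... n_s].

    The subgroup [F] is the internal direct product of [V] and [T]: its elements are the
    classes of [rho v (x) diag t], where [rho] is a projective representation of [V] on
    [C^N] with commutators [b].  Everything that is needed about [rho] is collected in
    the predicate [heisenberg]: [b] is nondegenerate, [rho] is irreducible, and every
    character of [V] is of the form [b w].  These properties hold for one [H_k], where
    they are the algebra of the clock and shift matrices, and they pass to tensor
    products ([heisenberg_prod], [heisenberg_Va]).

    Let [g] normalise [F].  Commutators of unitary lifts are invariant under conjugation,
    and the commutator pairing of [F] is [b] extended trivially over [T].  So [T], the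
    radical of this pairing, is preserved ([norm_torus]), and the automorphism induced on
    [F / T = V] preserves [b].  On [T] the element [g] acts by a permutation of
    coordinates: a lift of [g] moves the eigenspaces of a diagonal matrix with distinct
    coordinates, and these eigenspaces are the [m] summands [C^N (x) e_j]
    ([norm_perm]).  Hence conjugation by [g] has the form
    [(v, x) |-> (al v, phi (al v) * s x)] with [al] in [Sp V], [s] in [S_m] and [phi] in
    [Hom(V, T)] ([acts_as_total]), and composing such maps gives the multiplication of
    the semidirect product ([acts_asM]).  The triple determines the action and is
    determined by it, so the kernel of [g |-> (phi, (s, al))] is the centraliser of [F].

    Every triple occurs ([acts_as_surj]).  A permutation is realised by
    [1 (x) perm_mx s].  For [phi], the ratio of the [j]-th to the first coordinate is a
    character of [V], hence some [b (w_ j)], and the block diagonal matrix with blocks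
    [rho (w_ j)] acts as required.  For [al], a unitary [U] with
    [U rho(v) U^-1 = rho(al v)] up to scalars is needed, as in the Stone-von Neumann
    theorem.  The operators [X |-> rho(al v) X rho(v)^-1] commute, because [al]
    preserves [b], so they have a common eigenvector [X]; by irreducibility [X^* X] is
    a positive scalar, and rescaling [X] gives [U] ([intertwiner]). *)

Set Implicit Arguments.
Unset Strict Implicit.
Unset Printing Implicit Defensive.

Import Order.TTheory GRing.Theory Num.Theory.
Local Open Scope quotient_scope.
Local Open Scope classical_set_scope.
Local Open Scope group_scope.

(** * Weyl groups from an action relation *)

(** A relation [Rel g u], read as [g acts by u], that is a surjective homomorphism from
    the normaliser with the centraliser as kernel.  Taking a relation in place of a
    function avoids choosing [u] before the quotient is formed. *)
Lemma weyl_isomorphic (G K : groupType) (F : set G) (Rel : G -> K -> Prop) :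
  (forall g u, Rel g u -> g \in normaliser F) ->
  (forall g, g \in normaliser F -> exists u, Rel g u) ->
  (forall u, exists g, Rel g u) ->
  (forall g u u', Rel g u -> Rel g u' -> u = u') ->
  (forall g h u v, Rel g u -> Rel h v -> Rel (g * h) (u * v)) ->
  (forall g, Rel g 1 <-> g \in centraliser F) ->
  isomorphic (weyl F) K.
Proof.
move=> RN Rtot Rsurj Rfun RM R1.
pose f (x : weyl F) : K := xget 1 [set u | Rel (subg_val (repr x)) u].
have fP x : Rel (subg_val (repr x)) (f x).
  by apply: (@xgetPex _ 1 [set u | Rel _ u]); exact: Rtot (valP (repr x)).
have ker g h u : Rel g u -> Rel h u -> g^-1 * h \in centraliser F.
  move=> gu hu; apply/R1.
  have [g' g'u] : exists g', Rel g' u^-1 by exact: Rsurj.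
  have g'g : Rel (g' * g) 1 by rewrite -(mulVg u); exact: RM.
  have g'h : Rel (g' * h) 1 by rewrite -(mulVg u); exact: RM.
  have -> : g^-1 * h = (g' * g)^-1 * (g' * h).
    by rewrite invgM -mulgA mulKg.
  by apply/R1; rewrite gpredM ?gpredV //; exact/R1.
have coset (g h : subg_of (normaliser F)) u : Rel (subg_val g) u ->
    Rel (subg_val h) u -> (g^-1 * h)%g \in @centraliser_in G F.
  by move=> gu hu; exact: ker gu hu.
have coset' (g h : subg_of (normaliser F)) u : (g^-1 * h)%g \in @centraliser_in G F ->
    Rel (subg_val g) u -> Rel (subg_val h) u.
  move=> gh gu.
  have -> : subg_val h = subg_val g * subg_val (g^-1 * h).
    by rewrite /= mulVKg.
  rewrite -(mulg1 u); apply: RM => //; exact/R1.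
have fpi g u : Rel (subg_val g) u -> f (\pi_(quotg (@centraliser_in G F)) g) = u.
  move=> gu; apply: (Rfun _ _ _ (fP (\pi_(quotg (@centraliser_in G F)) g))).
  by apply: coset' gu; apply/eq_quotgP; rewrite reprK.
have fM : {morph f : x y / x * y}.
  move=> x y; have -> : x * y = \pi_(quotg (@centraliser_in G F)) (repr x * repr y).
    by rewrite quotgM !reprK.
  have := RM _ _ _ _ (fP x) (fP y).
  exact: (fpi (repr x * repr y)%g).
pose fm : {multiplicative weyl F -> K} := HB.pack f (isMultiplicative.Build _ _ f fM).
exists fm.
have Rinv u : exists x, f x = u.
  have [g gu] := Rsurj u.
  by exists (\pi_(quotg (@centraliser_in G F)) (SubgOf (RN _ _ gu))); exact: fpi.
have [finv finvK] := choice Rinv.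
exists finv => //= x.
have := fP (finv (f x)); rewrite finvK => fx'.
by have /eq_quotgP := coset _ _ _ fx' (fP x); rewrite !reprK.
Qed.

(** * Tensor products and commutators up to scalars *)

Section Omega.
Variable R : realType.
Local Open Scope ring_scope.
Local Notation C := R[i].

(** If [omega^i = 1] then [cos (2 t) = 1] for [t = pi i / k], so [sin t = 0], which
    fails when [0 < i < k]. *)
Lemma omega_primitive k : (0 < k)%N -> k.-primitive_root (omega R k).
Proof.
move=> k0; apply/andP; split=> //; apply/forallP => i; rewrite unity_rootE.
have [ik|ik] := eqVneq i.+1 k; first by rewrite ik omega_prim // eqxx.
have {}ik : (i.+1 < k)%N by rewrite ltn_neqAle ik ltn_ord.
apply/eqP/negbTE/negP; rewrite omegaX => /eqP [c1 _].
pose t : R := trigo.pi / k%:R *+ i.+1.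
have tE : 2 * trigo.pi / k%:R *+ i.+1 = t *+ 2.
  by rewrite /t -mulrnA mulnC mulrnA -!mulrA [2 * _]mulr_natl.
have t0 : 0 < t < trigo.pi.
  have k0' : (0 : R) < k%:R by rewrite ltr0n.
  rewrite /t -mulr_natr mulrAC pmulr_lgt0 ?invr_gt0 // mulr_gt0 ?pi_gt0 ?ltr0n //=.
  by rewrite ltr_pdivrMr // ltr_pM2l ?pi_gt0 // ltr_nat.
move: c1; rewrite tE cos_mulr2n => /(canRL (subrK _)); rewrite -[1 + 1]/(2 : R).
have := sin_gt0_pi t0 => s0 c2.
have : cos t ^+ 2 = 1 by apply/(@mulIf _ 2); rewrite ?pnatr_eq0 // mul1r mulr_natr c2.
move/eqP; rewrite -subr_eq0 -(cos2Dsin2 t) opprD addrA subrr sub0r oppr_eq0.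
by rewrite expf_eq0 /= gt_eqF.
Qed.

End Omega.

Section MatrixBlocks.
Variables (C : comNzRingType) (p q : nat).
Local Open Scope ring_scope.

Lemma sum_mxtens (F : 'I_(p * q) -> C) :
  \sum_r F r = \sum_i \sum_j F (mxtens_index (i, j)).
Proof.
rewrite (reindex (@mxtens_index p q)) /=; last first.
  by apply: onW_bij; exists (@mxtens_unindex p q);
    [exact: mxtens_indexK|exact: mxtens_unindexK].
by rewrite pair_big; apply: eq_bigr => -[].
Qed.

(** With respect to [C^p (x) C^q], the block is the entry in position [(k, l)] of [X]
    seen as a [q x q] matrix over ['M_p]; products with [A (x) 1] act entrywise. *)
Definition mxtens_block (X : 'M[C]_(p * q)) (k l : 'I_q) : 'M[C]_p :=
  \matrix_(i, j) X (mxtens_index (i, k)) (mxtens_index (j, l)).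

Lemma mxtens_blockMl (A : 'M[C]_p) X k l :
  mxtens_block ((A *t 1%:M) *m X) k l = A *m mxtens_block X k l.
Proof.
apply/matrixP => i j; rewrite !mxE sum_mxtens; apply: eq_bigr => r _.
rewrite (bigD1 k) //= big1 => [|c ck]; first by rewrite tensmxE !mxE eqxx mulr1 addr0.
by rewrite tensmxE !mxE eq_sym (negPf ck) mulr0 mul0r.
Qed.

Lemma mxtens_blockMr (A : 'M[C]_p) X k l :
  mxtens_block (X *m (A *t 1%:M)) k l = mxtens_block X k l *m A.
Proof.
apply/matrixP => i j; rewrite !mxE sum_mxtens; apply: eq_bigr => r _.
rewrite (bigD1 l) //= big1 => [|c cl]; first by rewrite tensmxE !mxE eqxx mulr1 addr0.
by rewrite tensmxE !mxE (negPf cl) !mulr0.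
Qed.

Lemma mxtens_scalar c d : c%:M *t d%:M = (c * d)%:M :> 'M[C]_(p * q).
Proof.
apply/matrixP => i j; case: (mxtens_indexP i) => i1 i2.
case: (mxtens_indexP j) => j1 j2; rewrite tensmxE !mxE.
rewrite (can_eq (@mxtens_indexK p q)) xpair_eqE.
by case: eqVneq; case: eqVneq; rewrite ?mulr1n ?mulr0n ?mulr0 ?mul0r.
Qed.

(** If both sets of matrices have only scalar commutant, so does the set of their
    tensor products: commuting with the left factors makes every block scalar,
    hence [X = 1 (x) Y], and then [Y] commutes with the right factors. *)
Lemma tens_irr (I J : Type) (f : I -> 'M[C]_p) (g : J -> 'M[C]_q) (X : 'M[C]_(p * q)) :
  (0 < p)%N ->
  (forall Y : 'M[C]_p, (forall i, comm_mx (f i) Y) -> is_scalar_mx Y) ->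
  (forall Y : 'M[C]_q, (forall j, comm_mx (g j) Y) -> is_scalar_mx Y) ->
  (forall i, comm_mx (f i *t 1%:M) X) -> (forall j, comm_mx (1%:M *t g j) X) ->
  is_scalar_mx X.
Proof.
move=> p0 firr girr fX gX; have i0 : 'I_p := Ordinal p0.
have scal k l : is_scalar_mx (mxtens_block X k l).
  by apply: firr => i; rewrite /comm_mx -mxtens_blockMl -mxtens_blockMr fX.
pose Y : 'M[C]_q := \matrix_(k, l) mxtens_block X k l i0 i0.
have XY : X = 1%:M *t Y.
  apply/matrixP => i j; case: (mxtens_indexP i) => i1 i2.
  case: (mxtens_indexP j) => j1 j2; rewrite tensmxE.
  have /is_scalar_mxP[z /matrixP Xz] := scal i2 j2.
  have Xz' := Xz i1 j1; rewrite mxE in Xz'; rewrite Xz' [Y _ _]mxE Xz !mxE eqxx.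
  by case: eqVneq; rewrite ?mul1r ?mul0r ?mulr0n ?mulr1n.
have /is_scalar_mxP[z Yz] : is_scalar_mx Y.
  apply: girr => w; apply/matrixP => k l.
  have := gX w; rewrite /comm_mx XY !tensmx_mul !mul1mx.
  move=> /matrixP/(_ (mxtens_index (i0, k)) (mxtens_index (i0, l))).
  by rewrite !tensmxE !mxE eqxx !mul1r.
by apply/is_scalar_mxP; exists z; rewrite XY Yz mxtens_scalar mul1r.
Qed.

End MatrixBlocks.

Section Qcomm.
Variable R : realType.
Local Notation C := R[i].

Lemma scalar_unitary_inj n : 0 < n -> injective (@scalar_unitary R n).
Proof.
case: n => // n _ z w /(congr1 (fun A => umx A ord0 ord0)).
by rewrite /= !mxE eqxx !mulr1n => /val_inj.
Qed.

Lemma umxM n (A B : unitary R n) : umx (A * B) = (umx A *m umx B)%R.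
Proof. by []. Qed.

Lemma PUclassV n (A : unitary R n) : PUclass A^-1 = (PUclass A)^-1.
Proof. exact: quotgV. Qed.

Lemma PUclassJ n (A B : unitary R n) : PUclass (A ^ B) = PUclass A ^ PUclass B.
Proof. by rewrite !conjgE !PUclassM PUclassV. Qed.

Lemma PUclass1P n (A : unitary R n) :
  PUclass A = 1 <-> exists z, A = scalar_unitary n z.
Proof.
rewrite -[1]/(PUclass (1 : unitary R n)); split=> [/esym/PUclassP[z ->]|[z ->]].
  by exists z; rewrite mul1g.
by apply/esym/PUclassP; exists z; rewrite mul1g.
Qed.

Lemma scalar_mx_unitary n (A : unitary R n) : 0 < n ->
  is_scalar_mx (umx A) -> PUclass A = 1.
Proof.
move=> n0 /is_scalar_mxP[c Ac]; apply/PUclass1P.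
have /unitarymxP := umxP A; rewrite Ac tr_scalar_mx map_scalar_mx -scalar_mxM.
case: n n0 A Ac => // n _ A Ac /matrixP/(_ ord0 ord0).
rewrite !mxE eqxx !mulr1n -normCK => /eqP; rewrite sqrp_eq1 // => c1.
by exists (Circle c1); exact: val_inj.
Qed.

(** The commutator of [A] and [B] is the scalar [z].  As an equation without inverses,
    this passes directly to products, conjugates and tensor products. *)
Definition qcomm n (z : circle R) (A B : unitary R n) : Prop :=
  A * B = scalar_unitary n z * (B * A).

Section Dim.
Variable n : nat.
Implicit Types (A B D : unitary R n) (z w : circle R).

Lemma qcomm_uniq z w A B : 0 < n -> qcomm z A B -> qcomm w A B -> z = w.
Proof. by move=> n0; rewrite /qcomm => -> /mulIg/scalar_unitary_inj->. Qed.

Lemma qcommE z A B : A * B * A^-1 * B^-1 = scalar_unitary n z <-> qcomm z A B.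
Proof.
rewrite /qcomm; split=> [<-|AB]; first by rewrite !mulgA !mulgVK.
by rewrite AB !mulgA !mulgK.
Qed.

Lemma qcommMl z w A B D : qcomm z A D -> qcomm w B D -> qcomm (z * w) (A * B) D.
Proof.
rewrite /qcomm => AD BD.
rewrite -(mulgA A B D) BD (mulgA A) -(scalar_unitaryC w A) -(mulgA _ A).
by rewrite (mulgA A D B) AD mulgC scalar_unitaryM -!mulgA.
Qed.

Lemma qcommV z A B : qcomm z A B -> qcomm z^-1 B A.
Proof.
rewrite /qcomm => ->; rewrite mulgA -scalar_unitaryM mulVg.
by rewrite scalar_unitary1 mul1g.
Qed.

Lemma qcommMr z w A B D : qcomm z D A -> qcomm w D B -> qcomm (z * w) D (A * B).
Proof.
move=> /qcommV DA /qcommV DB; rewrite -[z * w]invgK; apply: qcommV.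
by rewrite invgM mulgC; exact: qcommMl.
Qed.

Lemma qcomm_scalarl z A : qcomm 1 (scalar_unitary n z) A.
Proof. by rewrite /qcomm scalar_unitary1 mul1g scalar_unitaryC. Qed.

Lemma qcomm1 A B : qcomm 1 A B <-> commute A B.
Proof. by rewrite /qcomm scalar_unitary1 mul1g. Qed.

Lemma qcommJ z A B D : qcomm z A B -> qcomm z (A ^ D) (B ^ D).
Proof.
rewrite /qcomm -!conjMg => ->; rewrite (conjMg (scalar_unitary n z)); congr (_ * _).
by rewrite conjgE scalar_unitaryC mulKg.
Qed.

Lemma qcomm_class z A B A' B' : PUclass A = PUclass A' ->
  PUclass B = PUclass B' -> qcomm z A B -> qcomm z A' B'.
Proof.
move=> /PUclassP[u ->] /PUclassP[v ->] AB.
rewrite -[z]mulg1; apply: qcommMl; last exact: qcomm_scalarl.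
rewrite -[z]mulg1; apply: qcommMr => //.
by rewrite -[1]invg1; exact/qcommV/qcomm_scalarl.
Qed.

Lemma commmx_class (A B : unitary R n) (X : 'M[C]_n) : PUclass A = PUclass B ->
  comm_mx (umx A) X -> comm_mx (umx B) X.
Proof.
move=> /PUclassP[z ->] AX; rewrite /comm_mx /= mul_mx_scalar.
by rewrite -scalemxAl AX -scalemxAr.
Qed.

End Dim.

Lemma unitary_tensM p q (A A' : unitary R p) (B B' : unitary R q) :
  unitary_tens (A * A') (B * B') = unitary_tens A B * unitary_tens A' B'.
Proof. by apply/val_inj; rewrite /= tensmx_mul. Qed.

Lemma scalar_tens p q (z w : circle R) :
  unitary_tens (scalar_unitary p z) (scalar_unitary q w) =
  scalar_unitary (p * q) (z * w).
Proof. by apply/val_inj; rewrite /= mxtens_scalar. Qed.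

Lemma qcomm_tens p q z w (A A' : unitary R p) (B B' : unitary R q) :
  qcomm z A A' -> qcomm w B B' ->
  qcomm (z * w) (unitary_tens A B) (unitary_tens A' B').
Proof.
by rewrite /qcomm -!unitary_tensM => -> ->; rewrite unitary_tensM scalar_tens.
Qed.

Lemma PU_tensM p q (x x' : PU R p) (y y' : PU R q) :
  PU_tens (x * x') (y * y') = PU_tens x y * PU_tens x' y'.
Proof.
case: (PUclass_surj x) (PUclass_surj x') => A -> [A' ->].
case: (PUclass_surj y) (PUclass_surj y') => B -> [B' ->].
rewrite -(PUclassM A) -(PUclassM B) !PU_tensE unitary_tensM.
exact: PUclassM.
Qed.

End Qcomm.

(** * Heisenberg representations *)

Section Heisenberg.
Variable R : realType.
Local Notation C := R[i].

(** An irreducible projective representation of a finitely generated abelian group whose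
    commutators are given by a perfect pairing [b].  [heis_gen] is an induction principle
    over finitely many generators: it reduces a statement about all commuting operators
    of the representation to one about a finite list of them. *)
Record heisenberg (V : groupType) (b : V -> V -> circle R) (n : nat)
    (rho : V -> unitary R n) : Prop := {
  heis_dim : 0 < n;
  heis_hom : {morph (fun v => PUclass (rho v)) : v w / v * w};
  heis_comm : forall v w, qcomm (b v w) (rho v) (rho w);
  heis_nondeg : forall v, (forall w, b v w = 1) -> v = 1;
  heis_irr : forall X : 'M[C]_n,
    (forall v, comm_mx (umx (rho v)) X) -> is_scalar_mx X;
  heis_gen : exists gens : seq V, forall P : V -> Prop,
    P 1 -> (forall x y, P x -> P y -> P (x * y)) -> (forall x, P x -> P x^-1) ->
    {in gens, forall x, P x} -> forall x, P x;
  heis_dual : forall chi : V -> circle R, {morph chi : x y / x * y} ->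
    exists w, chi =1 b w
}.

Section Basic.
Variables (V : groupType) (b : V -> V -> circle R) (n : nat).
Variable rho : V -> unitary R n.
Hypothesis n0 : 0 < n.
Hypothesis rho_hom : {morph (fun v => PUclass (rho v)) : v w / v * w}.
Hypothesis rho_comm : forall v w, qcomm (b v w) (rho v) (rho w).

Lemma heis_one : PUclass (rho 1) = 1.
Proof. by apply: (mulgI (PUclass (rho 1))); rewrite -rho_hom !mulg1. Qed.

Lemma form_mull v w x : b (v * w) x = b v x * b w x.
Proof.
apply: (qcomm_uniq n0 (rho_comm _ _)).
apply: qcomm_class (qcommMl (rho_comm v x) (rho_comm w x)) => //.
by rewrite PUclassM rho_hom.
Qed.

Lemma form_inv v w : b w v = (b v w)^-1.
Proof. exact: qcomm_uniq n0 (rho_comm _ _) (qcommV (rho_comm _ _)). Qed.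

Lemma form_mulr v w x : b x (v * w) = b x v * b x w.
Proof. by rewrite form_inv form_mull invgM mulgC -!form_inv. Qed.

Lemma form_one v : b 1 v = 1.
Proof. by apply: (mulgI (b 1 v)); rewrite -form_mull !mulg1. Qed.

Lemma form_oner v : b v 1 = 1.
Proof. by rewrite form_inv form_one invg1. Qed.

Lemma form_expl v w i : b (v ^+ i) w = b v w ^+ i.
Proof. by elim: i => [|i IH]; rewrite ?expg0 ?form_one // !expgS form_mull IH. Qed.

End Basic.

Lemma heisenberg_unit :
  heisenberg (fun _ _ : unit => 1) (fun _ => 1 : unitary R 1).
Proof.
split=> //=.
- by move=> v w; rewrite -PUclassM mul1g.
- by move=> v w; exact/qcomm1.
- by case.
- by move=> X _; rewrite [X]mx11_scalar; exact: scalar_mx_is_scalar.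
- by exists [::] => P P1 _ _ _ [].
- move=> chi chiM; exists tt => -[]; apply: (mulgI (chi tt)).
  by rewrite mulg1 -chiM.
Qed.

Section Product.
Variables (V W : groupType).
Variables (b : V -> V -> circle R) (c : W -> W -> circle R) (p q : nat).
Variables (rho : V -> unitary R p) (sigma : W -> unitary R q).
Hypotheses (hb : heisenberg b rho) (hc : heisenberg c sigma).

Lemma heisenberg_prod : heisenberg
  (fun x y : (V * W)%type => b x.1 y.1 * c x.2 y.2)
  (fun x : (V * W)%type => unitary_tens (rho x.1) (sigma x.2)).
Proof.
have b1 := form_one (heis_dim hb) (heis_hom hb) (heis_comm hb).
have c1 := form_one (heis_dim hc) (heis_hom hc) (heis_comm hc).
have b1r := form_oner (heis_dim hb) (heis_hom hb) (heis_comm hb).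
have c1r := form_oner (heis_dim hc) (heis_hom hc) (heis_comm hc).
split=> /=.
- by rewrite muln_gt0 (heis_dim hb) (heis_dim hc).
- move=> [v w] [v' w'] /=; rewrite -!PU_tensE -PU_tensM.
  by rewrite -(heis_hom hb) -(heis_hom hc).
- by move=> v w; apply: qcomm_tens; [exact: heis_comm hb _ _|exact: heis_comm hc _ _].
- move=> [v w] vw1; congr (_, _).
    by apply: (heis_nondeg hb) => v'; have := vw1 (v', 1); rewrite /= c1r mulg1.
  by apply: (heis_nondeg hc) => w'; have := vw1 (1, w'); rewrite /= b1r mul1g.
- move=> X XC; apply: (tens_irr (heis_dim hb) (heis_irr hb) (heis_irr hc)).
    move=> v; apply: (@commmx_class _ _ (unitary_tens (rho v) (sigma 1))
      (unitary_tens (rho v) 1)); last exact: (XC (v, 1)).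
    by rewrite -!PU_tensE (heis_one (heis_hom hc)).
  move=> w; apply: (@commmx_class _ _ (unitary_tens (rho 1) (sigma w))
      (unitary_tens 1 (sigma w))); last exact: (XC (1, w)).
  by rewrite -!PU_tensE (heis_one (heis_hom hb)).
- have [gb gbP] := heis_gen hb; have [gc gcP] := heis_gen hc.
  exists ([seq (v, 1) | v <- gb] ++ [seq (1, w) | w <- gc]) => P P1 PM PV Pg.
  have Pv v : P (v, 1).
    apply: (gbP (fun v => P (v, 1))) => // [x y Px Py|x Px|x xg].
    - by have := PM _ _ Px Py; rewrite -[_ * _]/(_, _) /= mulg1.
    - by have := PV _ Px; rewrite -[_^-1]/(_, _) /= invg1.
    - by apply: Pg; rewrite mem_cat map_f.
  have Pw w : P (1, w).
    apply: (gcP (fun w => P (1, w))) => // [x y Px Py|x Px|x xg].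
    - by have := PM _ _ Px Py; rewrite -[_ * _]/(_, _) /= mulg1.
    - by have := PV _ Px; rewrite -[_^-1]/(_, _) /= invg1.
    - by apply: Pg; rewrite mem_cat (map_f (pair 1)) ?orbT.
  by move=> [v w]; have := PM _ _ (Pv v) (Pw w);
    rewrite -[_ * _]/(_, _) /= mulg1 mul1g.
- move=> chi chiM.
  have [v|v vP] := heis_dual hb (chi := fun v => chi (v, 1)) _.
    by move=> x; rewrite -chiM -[_ * _ in RHS]/(_, _) /= mulg1.
  have [w|w wP] := heis_dual hc (chi := fun w => chi (1, w)) _.
    by move=> x; rewrite -chiM -[_ * _ in RHS]/(_, _) /= mulg1.
  exists (v, w) => -[x y] /=; rewrite -vP -wP -chiM -[(x, 1) * _]/(_, _) /=.
  by rewrite mulg1 mul1g.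
Qed.

End Product.

End Heisenberg.

(** * The group generated by clock and shift *)

Section HkHeisenberg.
Variable R : realType.
Local Notation C := R[i].

Section ClockShift.
Local Open Scope ring_scope.

(** Commuting with the clock, whose diagonal entries are distinct, makes [X] diagonal;
    commuting with the shift makes its diagonal constant. *)
Lemma clock_shift_irr k (X : 'M[C]_k) :
  comm_mx (clock_mx R k) X -> comm_mx (shift_mx R k) X -> is_scalar_mx X.
Proof.
case: k X => [|k] X cX sX.
  by apply/is_scalar_mxP; exists 0; apply/matrixP => -[].
have offdiag i j : i != j -> X i j = 0.
  move=> ij; move/matrixP/(_ i j): cX; rewrite mul_diag_mx mul_mx_diag !mxE.
  move/eqP; rewrite [X in _ == X]mulrC -subr_eq0 -mulrBl mulf_eq0 => /orP[|/eqP//].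
  rewrite subr_eq0 (eq_prim_root_expr (omega_primitive R (ltn0Sn k))).
  by rewrite !modn_small // => /eqP/val_inj ij'; rewrite ij' eqxx in ij.
have diagS i : X (ordS i) (ordS i) = X i i.
  move/matrixP/(_ i (ordS i)): sX; rewrite !mxE (bigD1 (ordS i)) //=.
  rewrite mxE eqxx mul1r big1 ?addr0 => [->|l /negPf li]; last by rewrite mxE li mul0r.
  rewrite (bigD1 i) //= mxE eqxx mulr1 big1 ?addr0 // => l li.
  by rewrite mxE (can_eq (@ordSK k.+1)) eq_sym (negPf li) mulr0.
have diag i (ik : (i < k.+1)%N) : X (Ordinal ik) (Ordinal ik) = X ord0 ord0.
  elim: i ik => [|i IH] ik; first by rewrite (_ : Ordinal ik = ord0) //; exact: val_inj.
  rewrite -(IH (ltnW ik)) -(diagS (Ordinal (ltnW ik))).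
  suff <- : Ordinal ik = ordS (Ordinal (ltnW ik)) by [].
  by apply: val_inj; rewrite /= modn_small.
apply/is_scalar_mxP; exists (X ord0 ord0); apply/matrixP => i j; rewrite mxE.
have [<-|ij] := eqVneq i j; last exact: offdiag.
by case: i => i ik; rewrite diag mulr1n.
Qed.

Lemma clockX k n : umx (clock R k ^+ n)%g = diag_mx (\row_i omega R k ^+ (i * n)).
Proof.
elim: n => [|n IH].
  rewrite expg0 /=; apply/matrixP => i j; rewrite !mxE muln0 expr0.
  by case: eqVneq.
rewrite expgS [LHS]/= IH mulmx_diag; congr diag_mx; apply/rowP => i.
by rewrite !mxE -exprD mulnS.
Qed.

Lemma shiftX k n i j : umx (shift R k ^+ n)%g i j = (j == iter n (@ordS k) i)%:R.
Proof.
elim: n i => [|n IH] i; first by rewrite expg0 /= mxE eq_sym.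
rewrite expgS [umx _]/= mxE (bigD1 (ordS i)) //= mxE eqxx mul1r IH -iterSr /=.
by rewrite big1 ?addr0 // => l /negPf li; rewrite mxE li mul0r.
Qed.

Lemma clock_expk k : (0 < k)%N -> (clock R k ^+ k = 1)%g.
Proof.
move=> k0; apply/val_inj; rewrite [LHS]clockX; apply/matrixP => i j; rewrite !mxE.
by rewrite mulnC exprM omega_prim // expr1n.
Qed.

Lemma shift_expk k : (0 < k)%N -> (shift R k ^+ k = 1)%g.
Proof.
case: k => // k _; apply/val_inj/matrixP => i j; rewrite [LHS]shiftX !mxE.
suff -> : iter k.+1 (@ordS k.+1) i = i by rewrite eq_sym.
have iterS n : iter n (@ordS k.+1) i = ((i + n) %% k.+1)%N :> nat.
  elim: n => [|n IH] /=; first by rewrite addn0 modn_small.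
  by rewrite IH -addn1 modnDml addn1 addnS.
by apply/val_inj; rewrite [LHS]iterS modnDr modn_small.
Qed.

End ClockShift.

Variable k : nat.
Hypothesis k0 : 0 < k.

Lemma generated_sub (G : groupType) (A : set G) x : A x -> x \in generated A.
Proof. by move=> Ax; apply/asboolP => K AK; exact: AK. Qed.

Definition Hclock : Hk R k :=
  SubgOf (generated_sub (or_introl erefl : clock_shift (PUclass (clock R k)))).
Definition Hshift : Hk R k :=
  SubgOf (generated_sub (or_intror erefl : clock_shift (PUclass (shift R k)))).

Definition Hlift (x : Hk R k) : unitary R k := repr (subg_val x).

Lemma HliftK x : PUclass (Hlift x) = subg_val x.
Proof. exact: reprK. Qed.

Lemma Hlift_morph : {morph (fun x => PUclass (Hlift x)) : x y / x * y}.
Proof. by move=> x y; rewrite !HliftK. Qed.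

Lemma Hlift_comm x y : qcomm (Hform x y) (Hlift x) (Hlift y).
Proof. by apply/qcommE/HformE; exact: HliftK. Qed.

Lemma Hk_gen (P : Hk R k -> Prop) : P 1 ->
  (forall x y, P x -> P y -> P (x * y)) -> (forall x, P x -> P x^-1) ->
  P Hclock -> P Hshift -> forall x, P x.
Proof.
move=> P1 PM PV Pc Ps.
pose S : {pred PU R k} := [pred z | `[< exists2 x, P x & z = subg_val x >]].
have SM : mulg_closed S.
  move=> _ _ /asboolP[x Px ->] /asboolP[y Py ->].
  by apply/asboolP; exists (x * y); first exact: PM.
have S1 : 1 \in S by apply/asboolP; exists 1.
have SV : invg_closed S.
  by move=> _ /asboolP[x Px ->]; apply/asboolP; exists x^-1; first exact: PV.
pose K : groupClosed (PU R k) := HB.pack S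
  (isMulClosed.Build _ S SM) (isMul1Closed.Build _ S S1) (isInvClosed.Build _ S SV).
move=> x; have /asboolP/(_ K) := valP x.
have csK y : clock_shift y -> y \in K.
  by case=> ->; apply/asboolP; [exists Hclock|exists Hshift].
by move=> /(_ csK)/asboolP[y Py /val_inj ->].
Qed.

Let form_mull := form_mull k0 Hlift_morph Hlift_comm.
Let form_mulr := form_mulr k0 Hlift_morph Hlift_comm.
Let form_one := form_one k0 Hlift_morph Hlift_comm.
Let form_inv := form_inv k0 Hlift_comm.
Let form_expl := form_expl k0 Hlift_morph Hlift_comm.

Lemma Hform_shift_clock : circle_val (Hform Hshift Hclock) = omega R k.
Proof.
have w1 : `|omega R k|%R == 1%R by rewrite norm_omega.
suff -> : Hform Hshift Hclock = Circle w1 by [].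
apply: (qcomm_uniq k0 (Hlift_comm _ _)).
apply: (@qcomm_class _ _ _ (shift R k) (clock R k)); rewrite ?HliftK //.
rewrite /qcomm scalar_unitaryC; apply/val_inj; exact/esym/clock_shift_mul.
Qed.

Lemma Hform_alt (x : Hk R k) : Hform x x = 1.
Proof. by apply: (qcomm_uniq k0 (Hlift_comm _ _)); exact/qcomm1. Qed.

Lemma circle_root (z : circle R) : z ^+ k = 1 -> exists i, z = Hform Hshift Hclock ^+ i.
Proof.
have valX (w : circle R) n : circle_val (w ^+ n) = (circle_val w ^+ n)%R.
  by elim: n => // n IH; rewrite expgS exprS /= IH.
move=> /(congr1 (@circle_val R)); rewrite valX => zk.
have [i zi] := prim_rootP (omega_primitive R k0) zk.
by exists i; apply/val_inj; rewrite /= valX Hform_shift_clock.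
Qed.

Lemma Hclock_expk : Hclock ^+ k = 1.
Proof.
have valX (n : nat) : subg_val (Hclock ^+ n) = PUclass (clock R k ^+ n).
  by elim: n => // n IH; rewrite !expgS PUclassM /= IH.
by apply/val_inj; rewrite /= valX clock_expk.
Qed.

Lemma Hshift_expk : Hshift ^+ k = 1.
Proof.
have valX (n : nat) : subg_val (Hshift ^+ n) = PUclass (shift R k ^+ n).
  by elim: n => // n IH; rewrite !expgS PUclassM /= IH.
by apply/val_inj; rewrite /= valX shift_expk.
Qed.

Lemma Hlift_irr (X : 'M[C]_k) :
  comm_mx (umx (Hlift Hclock)) X -> comm_mx (umx (Hlift Hshift)) X -> is_scalar_mx X.
Proof.
move=> cX sX; apply: clock_shift_irr.
  by apply: (commmx_class _ cX : comm_mx (umx (clock R k)) X); rewrite HliftK.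
by apply: (commmx_class _ sX : comm_mx (umx (shift R k)) X); rewrite HliftK.
Qed.

(** The values of [chi] at the two generators are [k]-th roots of unity, hence powers of
    [b(shift, clock) = omega]; a product of powers of the shift and of the clock then
    pairs with the generators as [chi] does. *)
Lemma Hform_dual (chi : Hk R k -> circle R) : {morph chi : x y / x * y} ->
  exists w, chi =1 Hform w.
Proof.
move=> chiM.
have chi1 : chi 1 = 1 by apply: (mulgI (chi 1)); rewrite -chiM !mulg1.
have chiX x n : chi (x ^+ n) = chi x ^+ n.
  by elim: n => // n IH; rewrite !expgS chiM IH.
have chiV x : chi x^-1 = (chi x)^-1.
  by apply: (mulgI (chi x)); rewrite -chiM !mulgV.
have [i chic] : exists i, chi Hclock = Hform Hshift Hclock ^+ i.
  by apply: circle_root; rewrite -chiX Hclock_expk.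
have [j chis] : exists j, (chi Hshift)^-1 = Hform Hshift Hclock ^+ j.
  by apply: circle_root; rewrite expVgn -chiX Hshift_expk chi1 invg1.
(* the inverse in the choice of j reflects b(clock, shift) = omega^-1 *)
exists (Hshift ^+ i * Hclock ^+ j); apply: Hk_gen.
- by rewrite chi1 form_inv form_one invg1.
- by move=> x y ex ey; rewrite chiM ex ey form_mulr.
- move=> x ex; rewrite chiV ex; apply/esym.
  apply: (mulgI (Hform (Hshift ^+ i * Hclock ^+ j) x)).
  by rewrite -form_mulr !mulgV form_inv form_one invg1.
- by rewrite form_mull !form_expl Hform_alt expg1n mulg1.
- rewrite form_mull !form_expl Hform_alt expg1n mul1g form_inv expVgn -chis.
  by rewrite invgK.
Qed.

Lemma heisenberg_Hk : heisenberg (@Hform R k) Hlift.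
Proof.
split=> //.
- exact: Hlift_morph.
- exact: Hlift_comm.
- move=> v v1; apply/val_inj; rewrite /= -HliftK; apply: scalar_mx_unitary => //.
  apply: Hlift_irr.
    by have := Hlift_comm v Hclock; rewrite v1 => /qcomm1/(congr1 (@umx _ _))/esym.
  by have := Hlift_comm v Hshift; rewrite v1 => /qcomm1/(congr1 (@umx _ _))/esym.
- by move=> X XC; exact: Hlift_irr.
- exists [:: Hclock; Hshift] => P P1 PM PV Pg.
  by apply: Hk_gen => //; apply: Pg; rewrite !inE eqxx ?orbT.
- exact: Hform_dual.
Qed.

End HkHeisenberg.

Section VaHeisenberg.
Variable R : realType.

Fixpoint Va_lift (a : seq nat) : Va R a -> unitary R (tdim a 1) :=
  if a is k :: a' then
    fun v : Hk R k * Va R a' => unitary_tens (Hlift v.1) (Va_lift v.2)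
  else fun _ => 1.

Lemma heisenberg_Va a : all (fun k => 0 < k)%N a ->
  heisenberg (@Vform R a) (@Va_lift a).
Proof.
elim: a => [_|k a IH] /=; first exact: heisenberg_unit.
case/andP => k0 a0; exact: heisenberg_prod (heisenberg_Hk R k0) (IH a0).
Qed.

End VaHeisenberg.

(** * The subgroup F as a product of V and T *)

Section BlockTensor.
Variables (C : numClosedFieldType) (N m n : nat).
Variable e : 'I_n -> 'I_N * 'I_m.
Hypothesis e_bij : bijective e.
Local Open Scope ring_scope.

(** The tensor product of [X] and [B] along a bijection of the index set with a set of
    pairs. *)
Definition block_tens (X : 'M[C]_N) (B : 'M[C]_m) : 'M[C]_n :=
  \matrix_(p, q) (X (e p).1 (e q).1 * B (e p).2 (e q).2).

Lemma block_tensM X B Y D :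
  block_tens X B *m block_tens Y D = block_tens (X *m Y) (B *m D).
Proof.
apply/matrixP => p q; rewrite !mxE mulr_suml; under [RHS]eq_bigr do rewrite mulr_sumr.
rewrite pair_big /= (reindex e) /=; last exact: onW_bij.
by apply: eq_bigr => r _; rewrite !mxE mulrACA.
Qed.

Lemma block_tens_scalar c d : block_tens c%:M d%:M = (c * d)%:M.
Proof.
apply/matrixP => p q; rewrite !mxE -(inj_eq (bij_inj e_bij)) -pair_eqE /pair_eq /=.
by case: eqVneq; case: eqVneq; rewrite ?mulr1n ?mulr0n ?mul0r ?mulr0.
Qed.

Lemma block_tens_adj X B :
  map_mx Num.conj_op (block_tens X B)^T =
  block_tens (map_mx Num.conj_op X^T) (map_mx Num.conj_op B^T).
Proof. by apply/matrixP => p q; rewrite !mxE rmorphM. Qed.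

Lemma block_tens_unitary X B :
  X \is unitarymx -> B \is unitarymx -> block_tens X B \is unitarymx.
Proof.
move=> /unitarymxP XX /unitarymxP BB; apply/unitarymxP.
by rewrite block_tens_adj block_tensM XX BB block_tens_scalar mulr1.
Qed.

End BlockTensor.

Section TorusAndTensor.
Variable R : realType.
Local Notation C := R[i].

Section UTens.
Variables (N m n : nat) (e : 'I_n -> 'I_N * 'I_m).
Hypothesis e_bij : bijective e.

Definition utens (A : unitary R N) (B : unitary R m) : unitary R n :=
  Unitary (block_tens_unitary e_bij (umxP A) (umxP B)).

Lemma utensM A A' B B' : utens (A * A') (B * B') = utens A B * utens A' B'.
Proof. by apply/val_inj; rewrite /= block_tensM. Qed.

Lemma utens_scalar z w :
  utens (scalar_unitary N z) (scalar_unitary m w) = scalar_unitary n (z * w).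
Proof. by apply/val_inj; rewrite /= block_tens_scalar. Qed.

Lemma utens_class A A' B B' : PUclass A = PUclass A' -> PUclass B = PUclass B' ->
  PUclass (utens A B) = PUclass (utens A' B').
Proof.
move=> /PUclassP[z ->] /PUclassP[w ->]; apply/PUclassP; exists (z * w).
by rewrite utensM utens_scalar.
Qed.

Lemma qcomm_utens z w A A' B B' : qcomm z A A' -> qcomm w B B' ->
  qcomm (z * w) (utens A B) (utens A' B').
Proof. by rewrite /qcomm -!utensM => -> ->; rewrite utensM utens_scalar. Qed.

End UTens.

Section DiagU.
Variable m : nat.

Lemma torus_classM (s t : circle_pow R m) :
  torus_class (s * t) = torus_class s * torus_class t.
Proof. by rewrite /torus_class quotgM. Qed.

Lemma torus_perm_one (s : 'S_m) : torus_perm s (1 : torus R m) = 1.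
Proof.
by apply: (mulgI (torus_perm s (1 : torus R m))); rewrite -torus_perm_morph !mulg1.
Qed.

Fact diagU_proof (t : circle_pow R m) :
  diag_mx (\row_i circle_val (t i))%R \is @unitarymx C m m.
Proof.
apply/unitarymxP; rewrite tr_diag_mx map_diag_mx mulmx_diag.
apply/matrixP => i j; rewrite !mxE -normCK circle_norm expr1n.
by [].
Qed.
Definition diagU (t : circle_pow R m) : unitary R m := Unitary (diagU_proof t).

Lemma diagUM s t : diagU (s * t) = diagU s * diagU t.
Proof.
apply/val_inj; rewrite /= mulmx_diag; congr diag_mx; apply/rowP => i.
by rewrite !mxE ffunE.
Qed.

Lemma diagU_const z : diagU [ffun=> z] = scalar_unitary m z.
Proof. by apply/val_inj/matrixP => i j; rewrite !mxE ffunE. Qed.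

Lemma diagU_class s t : torus_class s = torus_class t ->
  PUclass (diagU s) = PUclass (diagU t).
Proof.
move=> /eq_quotgP/asboolP[z stz]; apply/PUclassP; exists z.
by rewrite -diagU_const -stz -diagUM mulVKg.
Qed.

Lemma maximal_torusP (x : PU R m) :
  maximal_torus x <-> exists t, x = PUclass (diagU t).
Proof.
split=> [[A /is_diag_mxP Ad ->]|[t ->]]; last first.
  by exists (diagU t) => //=; exact: diag_mx_is_diag.
have A1 i : (`|umx A i i| == 1)%R.
  have /unitarymxP/matrixP/(_ i i) := umxP A; rewrite !mxE (bigD1 i) //= big1 ?addr0.
    by rewrite !mxE eqxx -normCK => /eqP; rewrite sqrp_eq1.
  by move=> j ij; rewrite Ad ?mul0r // eq_sym.
exists [ffun i => Circle (A1 i)]; congr PUclass; apply/val_inj/matrixP => i j.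
rewrite !mxE ffunE /=; case: eqVneq => [<-|ij]; first by rewrite mulr1n.
by rewrite Ad.
Qed.

End DiagU.

Definition split_tens k q r m (f : 'I_q -> 'I_r * 'I_m) (p : 'I_(k * q)) :
    'I_(k * r) * 'I_m :=
  let: (i, j) := mxtens_unindex p in (mxtens_index (i, (f j).1), (f j).2).

Lemma split_tens_bij k q r m (f : 'I_q -> 'I_r * 'I_m) :
  bijective f -> bijective (@split_tens k q r m f).
Proof.
move=> [g gK Kg].
exists (fun u => let: (i, l) := mxtens_unindex u.1 in mxtens_index (i, g (l, u.2))).
  move=> p; case: (mxtens_indexP p) => i j; rewrite /split_tens !mxtens_indexK.
  by rewrite -surjective_pairing gK.
move=> [u l]; case: (mxtens_indexP u) => i j; rewrite /split_tens [(_, l).1]/=.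
by rewrite !mxtens_indexK Kg.
Qed.

(** The row indices of [A_1 (x) ... (x) A_s (x) B], nested to the right, as pairs of
    an index of [A_1 (x) ... (x) A_s] and an index of [B]: associativity of the tensor
    product on indices, without casts between equal dimensions. *)
Fixpoint split_index (a : seq nat) (m : nat) : 'I_(tdim a m) -> 'I_(tdim a 1) * 'I_m :=
  if a is k :: a' then @split_tens k _ _ m (@split_index a' m)
  else fun p => (ord0, p).

Lemma split_index_bij a m : bijective (@split_index a m).
Proof.
elim: a => [|k a IH] /=; last exact: split_tens_bij.
by exists snd => // -[k j]; rewrite [k]ord1.
Qed.

Lemma Va_tensE a m (v : Va R a) (B : unitary R m) :
  Va_tens v (PUclass B) = PUclass (utens (split_index_bij a m) (Va_lift v) B).
Proof.
elim: a v => [|k a IH] /=.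
  move=> _; congr PUclass; apply/val_inj/matrixP => i j.
  by rewrite !mxE mul1r.
move=> [x v] /=; rewrite IH -{1}(HliftK x) PU_tensE; congr PUclass.
apply/val_inj/matrixP => i j; rewrite !mxE /split_tens.
case: (mxtens_indexP i) => i1 i2; case: (mxtens_indexP j) => j1 j2.
by rewrite !mxtens_indexK /= mulrA.
Qed.

End TorusAndTensor.

Section FamElements.
Variable R : realType.
Local Notation C := R[i].
Variables (a : seq nat) (m : nat).
Hypotheses (a_gt0 : all (fun k => 0 < k)%N a) (m_gt0 : (0 < m)%N).
Local Notation V := (Va R a).
Local Notation N := (tdim a 1).
Local Notation n := (tdim a m).
Local Notation T := (torus R m).
Local Notation b := (@Vform R a).
Local Notation tens := (utens (split_index_bij a m)).
Let hV := heisenberg_Va R a_gt0.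

Lemma tdim_gt0 : (0 < n)%N.
Proof.
have := heis_dim hV; rewrite !tdimE muln1 => ?.
by rewrite muln_gt0 m_gt0 andbT.
Qed.

Definition Fam_elt (v : V) (x : T) : PU R n :=
  PUclass (tens (Va_lift v) (diagU (repr x))).

Lemma Fam_eltE v t : Fam_elt v (torus_class t) = PUclass (tens (Va_lift v) (diagU t)).
Proof. by apply: utens_class => //; apply: diagU_class; rewrite /torus_class reprK. Qed.

Lemma Fam_eltM v w x y : Fam_elt (v * w) (x * y) = Fam_elt v x * Fam_elt w y.
Proof.
case: (torus_surj x) (torus_surj y) => s -> [t ->].
rewrite -torus_classM !Fam_eltE -PUclassM -utensM diagUM.
by apply: utens_class => //; rewrite PUclassM -(heis_hom hV).
Qed.

Lemma Fam_eltP x : Fam R a m x <-> exists v y, x = Fam_elt v y.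
Proof.
split=> [[v [y [/maximal_torusP[t ->] ->]]]|[v [y ->]]].
  by exists v, (torus_class t); rewrite Va_tensE Fam_eltE.
case: (torus_surj y) => t ->; exists v, (PUclass (diagU t)).
by rewrite Fam_eltE Va_tensE; split=> //; apply/maximal_torusP; exists t.
Qed.

Lemma Fam_elt_qcomm A B v w x y : PUclass A = Fam_elt v x -> PUclass B = Fam_elt w y ->
  qcomm (b v w) A B.
Proof.
case: (torus_surj x) (torus_surj y) => s -> [t ->].
rewrite !Fam_eltE => /esym Av /esym Bw.
apply: qcomm_class Av Bw _; rewrite -[b v w]mulg1.
apply: qcomm_utens; first exact: heis_comm hV v w.
apply/qcomm1; rewrite /commute -!diagUM; congr diagU.
by apply/ffunP => i; rewrite !ffunE mulgC.
Qed.

(** The lift of [1] in [V] is only known up to a scalar [w], which cancels against the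
    scalar by which the two lifts of the torus elements differ. *)
Lemma Fam_elt1_inj x y : Fam_elt 1 x = Fam_elt 1 y -> x = y.
Proof.
case: (torus_surj x) (torus_surj y) => s -> [t ->]; rewrite !Fam_eltE.
case/PUclassP => z /(congr1 (@umx _ _))/matrixP stz.
have [g gK Kg] := split_index_bij a m.
have /PUclass1P[w w1] := heis_one (heis_hom hV).
apply/eq_quotgP/asboolP; exists z; apply/ffunP => i; rewrite !ffunE.
have i0 : 'I_N := Ordinal (heis_dim hV).
have := stz (g (i0, i)) (g (i0, i)).
rewrite w1 /= mul_mx_scalar !mxE !Kg /= !eqxx !mulr1n mulrCA.
move/(mulfI (circle_neq0 w)) => ts.
apply: (mulgI (s i)); rewrite mulVKg; apply/val_inj; rewrite /= ts.
exact: mulrC.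
Qed.

(** By bilinearity it is enough that [Fam_elt v x = 1] forces [v = 1].  An element of
    trivial class commutes with every lift, so [b v] is trivial. *)
Lemma Fam_elt_inj v w x y : Fam_elt v x = Fam_elt w y -> v = w /\ x = y.
Proof.
move=> vw; have {vw} : Fam_elt (v * w^-1) (x * y^-1) = Fam_elt 1 1.
  by rewrite Fam_eltM vw -Fam_eltM !mulgV.
set v' := v * _ => vw.
have v'1 : v' = 1.
  apply: (heis_nondeg hV) => u.
  rewrite -(form_one (heis_dim hV) (heis_hom hV) (heis_comm hV) u).
  apply: (qcomm_uniq tdim_gt0 (Fam_elt_qcomm (reprK _) (reprK (Fam_elt u 1)))).
  exact: Fam_elt_qcomm (etrans (reprK _) vw) (reprK _).
move: vw; rewrite v'1 => /Fam_elt1_inj/divg1_eq.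
by split=> //; apply/divg1_eq.
Qed.

End FamElements.

(** * Automorphisms of F induced by its normaliser *)

Section NormaliserAction.
Variable R : realType.
Local Notation C := R[i].
Variables (a : seq nat) (m : nat).
Hypotheses (a_gt0 : all (fun k => 0 < k)%N a) (m_gt0 : (0 < m)%N).
Local Notation V := (Va R a).
Local Notation N := (tdim a 1).
Local Notation n := (tdim a m).
Local Notation T := (torus R m).
Local Notation b := (@Vform R a).
Local Notation e := (@split_index a m).
Local Notation tens := (utens (split_index_bij a m)).
Local Notation F := (Fam R a m).
Local Notation Fam_elt := (@Fam_elt R a m).
Let hV := heisenberg_Va R a_gt0.
Let Fam_eltM := @Fam_eltM R a m a_gt0.
Let Fam_elt_inj := @Fam_elt_inj R a m a_gt0 m_gt0.
Let Fam_elt_qcomm := @Fam_elt_qcomm R a m a_gt0.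

Lemma norm_Fam_elt h v x : h \in normaliser F ->
  exists w y, Fam_elt v x ^ h = Fam_elt w y.
Proof.
move=> /asboolP/(_ (Fam_elt v x)) hF; apply/Fam_eltP; rewrite -hF.
by apply/Fam_eltP; exists v, x.
Qed.

Lemma norm_form h v w x y v' w' x' y' :
  Fam_elt v x ^ h = Fam_elt v' x' -> Fam_elt w y ^ h = Fam_elt w' y' -> b v' w' = b v w.
Proof.
move=> hv hw; case: (PUclass_surj h) => U hU.
have J (z : PU R n) : PUclass (repr z ^ U) = z ^ h by rewrite hU PUclassJ /PUclass reprK.
apply: (qcomm_uniq (tdim_gt0 R a_gt0 m_gt0)).
  exact: Fam_elt_qcomm (etrans (J _) hv) (etrans (J _) hw).
exact: qcommJ (Fam_elt_qcomm (reprK _) (reprK _)).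
Qed.

Lemma Vform_one v : b 1 v = 1.
Proof. exact: form_one (heis_dim hV) (heis_hom hV) (heis_comm hV) v. Qed.

(** [T] is the radical of the commutator pairing, so it is characteristic under
    conjugation by the normaliser: each [w] in [V] is hit, up to [T], by conjugation. *)
Lemma norm_torus h x v y : h \in normaliser F -> Fam_elt 1 x ^ h = Fam_elt v y -> v = 1.
Proof.
move=> hF hv; apply: (heis_nondeg hV) => w.
have hF' : h^-1 \in normaliser F by rewrite gpredV.
have [w0 [y0 hw]] := norm_Fam_elt w 1 hF'.
have {}hw : Fam_elt w0 y0 ^ h = Fam_elt w 1 by rewrite -hw conjgKV.
by rewrite (norm_form hv hw) Vform_one.
Qed.

Definition torus_lift (t : circle_pow R m) : unitary R n := tens 1 (diagU t).

Lemma torus_lift_class t : PUclass (torus_lift t) = Fam_elt 1 (torus_class t).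
Proof.
by rewrite Fam_eltE; apply: utens_class => //; rewrite (heis_one (heis_hom hV)).
Qed.

Lemma torus_liftE t :
  umx (torus_lift t) = diag_mx (\row_p circle_val (t (e p).2))%R.
Proof.
apply/matrixP => p q; rewrite !mxE.
rewrite -(inj_eq (bij_inj (split_index_bij a m))) -pair_eqE /pair_eq /=.
by case: eqVneq; case: eqVneq; rewrite ?mul1r ?mul0r ?mulr0n ?mulr0.
Qed.

Lemma unitary_row_neq0 (U : unitary R n) p : exists q, (umx U p q != 0)%R.
Proof.
apply/existsP; apply: contraT; rewrite negb_exists => /forallP U0.
have /(congr1 (fun A => umx A p p)) := mulgV U.
rewrite /= !mxE eqxx big1 => [/eqP|q _]; first by rewrite eq_sym oner_eq0.
by have := U0 q; rewrite negbK => /eqP ->; rewrite mul0r.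
Qed.

Lemma unitary_col_neq0 (U : unitary R n) q : exists p, (umx U p q != 0)%R.
Proof.
apply/existsP; apply: contraT; rewrite negb_exists => /forallP U0.
have /(congr1 (fun A => umx A q q)) := mulVg U.
rewrite /= !mxE eqxx big1 => [/eqP|p _]; first by rewrite eq_sym oner_eq0.
by have := U0 p; rewrite negbK => /eqP ->; rewrite mulr0.
Qed.

Lemma generic_circle_pow : exists t : circle_pow R m, injective t.
Proof.
have w1 i : (`|omega R m ^+ i| == 1)%R by rewrite normrX norm_omega expr1n.
exists [ffun i : 'I_m => Circle (w1 i)] => i j; rewrite !ffunE => -[] /eqP.
rewrite (eq_prim_root_expr (omega_primitive R m_gt0)) !modn_small //.
by move=> /eqP/val_inj.
Qed.

Lemma split_index_col (j : 'I_m) : exists p, (e p).2 = j.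
Proof.
have [g gK Kg] := split_index_bij a m.
by exists (g (Ordinal (heis_dim hV), j)); rewrite Kg.
Qed.

(** Let [U] lift [h] and write [D t] for [1 (x) diag t].  From [D t U = U D t'] one gets
    [t_i = t'_j] whenever the block [(i, j)] of [U] is nonzero.  For a [t] with distinct
    coordinates this leaves at most one nonzero block in each column; the column being
    nonzero, its position is [s0 j], and [s0] is onto because no row of [U] vanishes.
    The shape of [U] then determines its effect on every other [t]. *)
Lemma norm_perm h : h \in normaliser F ->
  exists s, forall x, Fam_elt 1 x ^ h = Fam_elt 1 (torus_perm s x).
Proof.
move=> hF; case: (PUclass_surj h) => U hU.
have Uconj t : exists t', torus_lift t * U = U * torus_lift t'.
  have [v [y hv]] := norm_Fam_elt 1 (torus_class t) hF.
  move: (hv); rewrite (norm_torus hF hv) => {v}hv.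
  move: hv; case: (torus_surj y) => t' ->.
  rewrite -!torus_lift_class hU -PUclassJ => /esym/PUclassP[z tz].
  exists (t' * [ffun=> z]); rewrite -[LHS](mulVKg U) -conjgE tz.
  rewrite /torus_lift diagUM -[1 in RHS]mulg1 utensM diagU_const; congr (_ * (_ * _)).
  by rewrite -scalar_unitary1 utens_scalar mul1g.
have Uentry t t' p q : torus_lift t * U = U * torus_lift t' -> umx U p q != 0%R ->
    t (e p).2 = t' (e q).2.
  move=> /(congr1 (@umx _ _)); rewrite !umxM !torus_liftE mul_diag_mx mul_mx_diag.
  move=> /matrixP/(_ p q); rewrite !mxE mulrC => tt' Upq; apply/val_inj.
  exact: mulfI Upq _ _ tt'.
have [t0 t0_inj] := generic_circle_pow; have [t1 t01] := Uconj t0.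
have [s0 s0P] : exists s0 : 'I_m -> 'I_m, forall j, t0 (s0 j) = t1 j.
  suff /choice[f fP] : forall j, exists i, t0 i = t1 j by exists f.
  move=> j; have [q <-] := split_index_col j.
  by have [p Upq] := unitary_col_neq0 U q; exists (e p).2; exact: Uentry t01 Upq.
have Us0 p q : umx U p q != 0%R -> (e p).2 = s0 (e q).2.
  by move=> Upq; apply: t0_inj; rewrite s0P; exact: Uentry t01 Upq.
have s0_surj i : exists j, s0 j = i.
  have [p <-] := split_index_col i; have [q Upq] := unitary_row_neq0 U p.
  by exists (e q).2; rewrite (Us0 _ _ Upq).
have s0_inj : injective s0.
  apply/injectiveP/card_uniqP; rewrite size_map -cardT.
  apply: eq_card => i; rewrite !inE; have [j <-] := s0_surj i.
  exact: map_f (mem_enum _ _).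
exists (perm s0_inj) => x; case: (torus_surj x) => t ->.
rewrite torus_permE -!torus_lift_class hU -PUclassJ; congr PUclass.
apply: (mulgI U); rewrite conjgE mulVKg; apply/val_inj.
rewrite [LHS]umxM [RHS]umxM !torus_liftE mul_diag_mx mul_mx_diag; apply/matrixP => p q.
rewrite !mxE ffunE permE mulrC; have [->|/Us0 ->//] := eqVneq (umx U p q) 0%R.
by rewrite !mul0r.
Qed.

(** Injectivity of [Fam_elt] turns the multiplicativity of conjugation into that of both
    components. *)
Lemma norm_factor h : h \in normaliser F -> exists (al : V -> V) (ta : V -> T),
  [/\ {morph al : x y / x * y}, {morph ta : x y / x * y},
      forall v w, b (al v) (al w) = b v w &
      forall v, Fam_elt v 1 ^ h = Fam_elt (al v) (ta v)].
Proof.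
move=> hF.
have [f fP] : exists f : V -> V * T, forall v, Fam_elt v 1 ^ h = Fam_elt (f v).1 (f v).2.
  suff /choice[f fP] : forall v, exists u : V * T,
    Fam_elt v 1 ^ h = Fam_elt u.1 u.2 by exists f.
  by move=> v; have [w [y hv]] := norm_Fam_elt v 1 hF; exists (w, y).
have fM v w : (f (v * w)).1 = (f v).1 * (f w).1 /\ (f (v * w)).2 = (f v).2 * (f w).2.
  by apply: Fam_elt_inj; rewrite -fP Fam_eltM -!fP -conjMg -Fam_eltM mulg1.
exists (fun v => (f v).1), (fun v => (f v).2); split=> // [v w|v w|v w].
- by have [] := fM v w.
- by have [] := fM v w.
- exact: norm_form (fP v) (fP w).
Qed.

Local Notation K := (semidirect (SSp_act R a m)).

(** Left conjugation is [_ ^ g^-1].  The homomorphism [phi] is evaluated at [al v], not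
    at [v]: this makes composition agree with the action
    [phi |-> s o phi o al^-1] of the semidirect product. *)
Definition acts_as (g : PU R n) (u : K) : Prop :=
  forall v x, Fam_elt v x ^ g^-1 =
    Fam_elt (faut u.2.2 v) (u.1 (faut u.2.2 v) * torus_perm u.2.1 x).

Lemma acts_as_norm g u : acts_as g u -> g \in normaliser F.
Proof.
move=> gu; apply/asboolP => z; split=> /Fam_eltP.
  move=> [v [x ->]]; apply/Fam_eltP.
  exists (faut_inv u.2.2 v), (torus_perm u.2.1^-1 ((u.1 v)^-1 * x)).
  apply/esym/(canRL (conjgKV g)).
  by rewrite gu faut_invK -torus_permM mulgV torus_perm1 mulVKg.
move=> [v [x zg]]; apply/Fam_eltP.
by rewrite -(conjgK g z) zg gu; eexists _, _.
Qed.

(** Conjugation by [g^-1] and by [g] both factor, and uniqueness of the components makes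
    the two induced maps of [V] inverse to each other. *)
Lemma acts_as_total g : g \in normaliser F -> exists u, acts_as g u.
Proof.
move=> gF; have hF : g^-1 \in normaliser F by rewrite gpredV.
have [s sP] := norm_perm hF; have [s' s'P] := norm_perm gF.
have [al [ta [alM taM alb alP]]] := norm_factor hF.
have [al' [ta' [al'M _ al'b al'P]]] := norm_factor gF.
have Fam_elt_split v x : Fam_elt v x = Fam_elt v 1 * Fam_elt 1 x.
  by rewrite -Fam_eltM mulg1 mul1g.
have alK : cancel al al'.
  move=> v; have := conjgKV g (Fam_elt v 1).
  by rewrite alP Fam_elt_split conjMg al'P s'P -Fam_eltM => /Fam_elt_inj[]; rewrite mulg1.
have al'K : cancel al' al.
  move=> v; have := conjgK g (Fam_elt v 1).
  by rewrite al'P Fam_elt_split conjMg alP sP -Fam_eltM => /Fam_elt_inj[]; rewrite mulg1.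
have phiM : {morph (fun v => ta (al' v)) : x y / x * y}.
  by move=> x y; rewrite al'M taM.
pose phi : group_hom V T := HB.pack (fun v => ta (al' v))
  (isMultiplicative.Build V T (fun v => ta (al' v)) phiM).
exists (phi, (s, FormAut alK al'K alM alb)) => v x /=.
by rewrite Fam_elt_split conjMg alP sP -Fam_eltM mulg1 alK.
Qed.

(** Test on the element with a single coordinate ['i], at position [s i], and all others
    equal to [1].  If [s' i] differs from [s i], the ratio of the two permuted elements
    takes both values ['i] and ['i^-1], which are distinct, so it is not constant.  A
    coordinate [-1] would fail for [m = 2], where swapping acts by inversion. *)
Lemma torus_perm_faithful (s s' : 'S_m) :
  (forall x : T, torus_perm s x = torus_perm s' x) -> s = s'.
Proof.
move=> ss'; apply/permP => i; apply/eqP; apply: contraT => sii'.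
have i1 : (`|'i : C| == 1)%R by rewrite normCi.
pose z := Circle i1.
have z2 : z != z^-1.
  apply/eqP => /(congr1 (mulg z)); rewrite mulgV => /(congr1 (@circle_val R)) /=.
  rewrite -expr2 sqrCi => /eqP; rewrite eq_sym -subr_eq0 opprK.
  by rewrite -[(1 + 1)%R]/(2%:R : C)%R pnatr_eq0.
pose f : circle_pow R m := [ffun j => if j == s i then z else 1].
have /eq_quotgP/asboolP[w /ffunP sw] :
  torus_class (permute s f) = torus_class (permute s' f) by rewrite -!torus_permE ss'.
have := sw i; rewrite !ffunE eqxx [s' i == _]eq_sym (negPf sii') mulg1 => zw.
have := sw (s'^-1 (s i))%g; rewrite !ffunE permKV eqxx (inj_eq perm_inj).
case: eqP => [si|_]; first by rewrite -[s i](permKV s') si eqxx in sii'.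
by rewrite invg1 mul1g -zw => ze; rewrite -ze eqxx in z2.
Qed.

Lemma acts_as_uniq g u u' : acts_as g u -> acts_as g u' -> u = u'.
Proof.
case: u u' => [phi [s al]] [phi' [s' al']] gu gu'.
have uu' v x := Fam_elt_inj (etrans (esym (gu v x)) (gu' v x)).
have al_eq : al = al' by apply: form_autP => v; have [] := uu' v 1.
rewrite -al_eq /= in uu' *.
have phi_eq : phi = phi'.
  apply: homP => v; have [_] := uu' (faut_inv al v) 1; rewrite faut_invK.
  by rewrite !torus_perm_one !mulg1.
rewrite phi_eq in uu' *; congr (_, (_, _)).
by apply: torus_perm_faithful => x; have [_ /mulgI] := uu' 1 x.
Qed.

Lemma acts_asM g h u w : acts_as g u -> acts_as h w -> acts_as (g * h) (u * w).
Proof.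
move=> gu hw v x; rewrite invgM conjgM hw gu.
congr (Fam_elt _ _) => /=.
by rewrite fautK torus_perm_morph torus_permM mulgA.
Qed.

Lemma acts_as1 g : acts_as g 1 <-> g \in centraliser F.
Proof.
split=> [g1|/asboolP gF v x].
  apply/asboolP => z /Fam_eltP[v [x ->]].
  have := g1 v x; rewrite /= mul1g torus_perm1 => g1'.
  by rewrite /commute -{2}g1' conjgE invgK !mulgA mulgVK.
have /gF gv : F (Fam_elt v x) by apply/Fam_eltP; exists v, x.
by rewrite /= mul1g torus_perm1 conjgE invgK mulgA gv mulgK.
Qed.

End NormaliserAction.

(** * Intertwiners for automorphisms of the form *)

Section Intertwiner.
Variable R : realType.
Local Notation C := R[i].
Variables (V : groupType) (b : V -> V -> circle R) (N : nat).
Variable rho : V -> unitary R N.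
Hypothesis hV : heisenberg b rho.
Variable al : V -> V.
Hypothesis alM : {morph al : x y / x * y}.
Hypothesis alb : forall v w, b (al v) (al w) = b v w.
Local Open Scope ring_scope.

(** [X] is an eigenvector of the operator [X |-> rho(al v) X rho(v)^-1]. *)
Definition intertwines (X : 'M[C]_N) (v : V) : Prop :=
  exists c : C, umx (rho (al v)) *m X = c *: (X *m umx (rho v)).

Lemma umx_mul_adj n (U : unitary R n) : umx U *m map_mx Num.conj_op (umx U)^T = 1%:M.
Proof. exact/unitarymxP/umxP. Qed.

Lemma umx_adj_mul n (U : unitary R n) : map_mx Num.conj_op (umx U)^T *m umx U = 1%:M.
Proof. exact/mulmx1C/umx_mul_adj. Qed.

Lemma mulmxUI n p (U : unitary R n) : injective (mulmx (umx U) : 'M[C]_(n, p) -> _).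
Proof.
apply: (can_inj (g := mulmx (map_mx Num.conj_op (umx U)^T))) => X.
by rewrite mulmxA umx_adj_mul mul1mx.
Qed.

Lemma mulmxIU n p (U : unitary R n) : injective (mulmxr (umx U) : 'M[C]_(p, n) -> _).
Proof.
apply: (can_inj (g := mulmxr (map_mx Num.conj_op (umx U)^T))) => X.
by rewrite /= -mulmxA umx_mul_adj mulmx1.
Qed.

Lemma heis_lift_mul v w : exists c : circle R,
  umx (rho (v * w)) = circle_val c *: (umx (rho v) *m umx (rho w)).
Proof.
have := heis_hom hV v w; rewrite /= -PUclassM => /esym/PUclassP[c ->].
by exists c; rewrite /= mul_mx_scalar.
Qed.

Lemma heis_lift_inv v : exists c : circle R,
  umx (rho v^-1%g) = circle_val c *: umx (rho v)^-1%g.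
Proof.
suff /PUclassP[c ->] : PUclass (rho v)^-1%g = PUclass (rho v^-1%g).
  by exists c; rewrite umxM mul_mx_scalar.
apply: (mulgI (PUclass (rho v))); rewrite -PUclassM mulgV -(heis_hom hV) mulgV.
by rewrite (heis_one (heis_hom hV)).
Qed.

Lemma intertwinesM X v w : intertwines X v -> intertwines X w ->
  intertwines X (v * w)%g.
Proof.
move=> [c cX] [d dX]; rewrite /intertwines alM.
have [u ->] := heis_lift_mul (al v) (al w); have [z vw] := heis_lift_mul v w.
exists (circle_val u * d * c / circle_val z).
rewrite vw -scalemxAl -scalemxAr -mulmxA dX -scalemxAr mulmxA cX.
rewrite -scalemxAl -mulmxA !scalerA.
by rewrite mulfVK ?circle_neq0 // mulrA.
Qed.

Lemma morph_one : al 1%g = 1%g.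
Proof. by apply: (mulgI (al 1%g)); rewrite -alM !mulg1. Qed.

Lemma intertwines1 X : intertwines X 1%g.
Proof.
exists 1; rewrite morph_one scale1r.
have /PUclass1P[z ->] := heis_one (heis_hom hV).
exact/esym/scalar_mxC.
Qed.

Lemma intertwinesV X v : X != 0 -> intertwines X v -> intertwines X v^-1%g.
Proof.
move=> X0 [c cX].
have c0 : c != 0.
  apply: contraNneq X0 => c0; apply/eqP; apply: (mulmxUI (U := rho (al v))).
  by rewrite /= cX c0 scale0r mulmx0.
have alV : al v^-1%g = (al v)^-1%g.
  by apply: (mulgI (al v)); rewrite -alM !mulgV morph_one.
have [z zE] := heis_lift_inv v; have [u uE] := heis_lift_inv (al v).
exists (circle_val u * c^-1 / circle_val z).
rewrite alV uE zE -scalemxAl -scalemxAr scalerA mulfVK ?circle_neq0 //.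
rewrite -scalerA; congr (_ *: _).
have VK : umx (rho v) *m umx (rho v)^-1%g = 1%:M by rewrite -umxM mulgV.
have alVK : umx (rho (al v))^-1%g *m umx (rho (al v)) = 1%:M by rewrite -umxM mulVg.
have Xv : X *m umx (rho v) = c^-1 *: (umx (rho (al v)) *m X).
  by rewrite cX scalerA mulVf // scale1r.
rewrite -{1}[X]mulmx1 -VK (mulmxA X) Xv -scalemxAl -scalemxAr.
by rewrite !mulmxA alVK mul1mx.
Qed.

(** The operators [L v] on ['M_N] commute: exchanging [v] and [w] multiplies the left
    factor by [b (al w) (al v)] and the right one by the inverse of [b w v].  A common
    eigenvector for the finitely many generators is one for all of [V]. *)
Lemma intertwiner_matrix : exists2 X : 'M[C]_N, X != 0 & forall v, intertwines X v.
Proof.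
have [gens gensP] := heis_gen hV.
pose L v : 'M[C]_(N * N) := lin_mulmx (umx (rho (al v))) *m lin_mulmxr (umx (rho v)^-1%g).
have LE v X : mxvec X *m L v = mxvec (umx (rho (al v)) *m X *m umx (rho v)^-1%g).
  by rewrite /L mulmxA !mul_vec_lin.
have LC v w : comm_mx (L v) (L w).
  apply/row_matrixP => i; rewrite !rowE.
  rewrite -[delta_mx 0 i]vec_mxK; move: (vec_mx _) => X.
  rewrite (mulmxA _ (L v)) (mulmxA _ (L w)) !LE; congr mxvec.
  have mid (A B D E : 'M[C]_N) : A *m (B *m X *m D) *m E = A *m B *m X *m (D *m E).
    by rewrite !mulmxA.
  rewrite !mid -!umxM -!invgM (heis_comm hV (al w)) (heis_comm hV w v) alb.
  rewrite (invgM (scalar_unitary _ _)).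
  rewrite !umxM (_ : umx (scalar_unitary _ _)^-1%g = (circle_val (b w v))^-1%:M).
    rewrite mul_mx_scalar /= mul_scalar_mx -!scalemxAl -scalemxAr scalerA.
    by rewrite mulfV ?circle_neq0 // scale1r.
  apply/(mulmxIU (U := scalar_unitary N (b w v))); rewrite /mulmxr -umxM mulVg /=.
  by rewrite -scalar_mxM mulVf ?circle_neq0.
have [x x0 /allP xP] : exists2 x : 'rV[C]_(N * N), x != 0 &
    all (fun A => stablemx x A) (map L gens).
  apply: common_eigenvector; first by rewrite muln_gt0 (heis_dim hV).
  by move=> _ _ /mapP[v _ ->] /mapP[w _ ->].
have X0 : vec_mx x != 0.
  by apply: contraNneq x0 => x0; rewrite -[x]vec_mxK x0 linear0.
exists (vec_mx x) => //; apply: gensP => [|v w|v|v vg].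
- exact: intertwines1.
- exact: intertwinesM.
- exact: intertwinesV.
have /sub_rVP[c] := xP _ (map_f L vg).
rewrite -{1}[x]vec_mxK LE => /(congr1 vec_mx); rewrite mxvecK linearZ => Xv.
exists c; rewrite scalemxAl -Xv -mulmxA -umxM mulVg mulmx1.
by [].
Qed.

Lemma adjZ p q (c : C) (M : 'M[C]_(p, q)) :
  map_mx Num.conj_op (c *: M)^T = c^* *: map_mx Num.conj_op M^T.
Proof. by apply/matrixP => i j; rewrite !mxE rmorphM. Qed.

Lemma trace_adj_mul_gt0 (X : 'M[C]_N) : X != 0 ->
  0 < \tr (map_mx Num.conj_op X^T *m X).
Proof.
move=> X0; rewrite mxtrace_mulC /mxtrace.
have trE i : (X *m map_mx Num.conj_op X^T) i i = \sum_j `|X i j| ^+ 2.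
  by rewrite mxE; apply: eq_bigr => j _; rewrite !mxE -normCK.
have sq_ge0 i j : 0 <= `|X i j| ^+ 2 by rewrite exprn_ge0.
have [i [j Xij]] : exists i j, X i j != 0.
  apply/not_existsP => Xi; case/eqP: X0; apply/matrixP => i j; rewrite mxE.
  by apply/eqP/negbNE/negP => Xij; apply: (Xi i); exists j.
rewrite (eq_bigr _ (fun i _ => trE i)) (bigD1 i) //= (bigD1 j) //=.
rewrite -addrA ltr_pwDl ?exprn_gt0 ?normr_gt0 // addr_ge0 ?sumr_ge0 // => k _.
exact: sumr_ge0.
Qed.

(** For [X] given by [intertwiner_matrix], [Y = X^* X] satisfies
    [Y = |c|^2 rho(v)^* Y rho(v)].  Comparing traces gives [|c| = 1], so [Y] commutes
    with the representation and is a scalar [d > 0]; then [X / sqrt d] is unitary. *)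
Lemma intertwiner : exists U : unitary R N,
  forall v, PUclass (U * rho v)%g = PUclass (rho (al v) * U)%g.
Proof.
have [X X0 XP] := intertwiner_matrix.
pose Y := map_mx Num.conj_op X^T *m X.
have Y0 : 0 < \tr Y by exact: trace_adj_mul_gt0.
have YE v : Y = map_mx Num.conj_op (umx (rho v))^T *m Y *m umx (rho v).
  have [c cX] := XP v.
  have Yc : Y = `|c| ^+ 2 *: (map_mx Num.conj_op (umx (rho v))^T *m Y *m umx (rho v)).
    rewrite /Y -{2}[X]mul1mx -(umx_adj_mul (rho (al v))) !mulmxA.
    rewrite -map_mxM -trmx_mul -mulmxA cX.
    rewrite adjZ trmx_mul map_mxM -scalemxAl -scalemxAr scalerA -normCKC.
    by rewrite !mulmxA.
  have : `|c| ^+ 2 * \tr Y = 1 * \tr Y.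
    rewrite {2}Yc mul1r mxtraceZ; congr (_ * _).
    by rewrite [RHS]mxtrace_mulC (mulmxA (umx (rho v))) umx_mul_adj mul1mx.
  by move/(mulIf (lt0r_neq0 Y0)) => c1; rewrite {1}Yc c1 scale1r.
have /is_scalar_mxP[d Yd] : is_scalar_mx Y.
  apply: (heis_irr hV) => v; rewrite /comm_mx {1}(YE v) -(mulmxA _ Y).
  by rewrite (mulmxA (umx (rho v))) umx_mul_adj mul1mx.
have d0 : 0 < d.
  by move: Y0; rewrite Yd mxtrace_scalar pmulrn_lgt0 // (heis_dim hV).
pose r := sqrtC d.
have r0 : 0 < r by rewrite sqrtC_gt0.
have UU : r^-1 *: X \is unitarymx.
  apply/unitarymxP/mulmx1C; rewrite adjZ -scalemxAl -scalemxAr scalerA.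
  rewrite -/Y Yd scale_scalar_mx.
  have -> : (r^-1)^* = r^-1 by apply/CrealP; rewrite rpredV gtr0_real.
  by rewrite -invfM -expr2 sqrtCK mulVf ?gt_eqF.
exists (Unitary UU) => v; apply/esym/divg1_eq; rewrite -PUclassV -PUclassM.
apply: (scalar_mx_unitary (heis_dim hV)); apply/is_scalar_mxP.
have [c cX] := XP v; exists c.
rewrite umxM [umx (rho (al v) * _)%g]/= -scalemxAr cX.
have -> : r^-1 *: (c *: (X *m umx (rho v))) = c *: umx (Unitary UU * rho v)%g.
  by rewrite /= -scalemxAl !scalerA mulrC.
by rewrite -scalemxAl -umxM mulgV scale_scalar_mx mulr1.
Qed.

End Intertwiner.

(** * Every triple is realised *)

Section BlockDiag.
Variables (C : numClosedFieldType) (N m n : nat).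
Variable e : 'I_n -> 'I_N * 'I_m.
Hypothesis e_bij : bijective e.
Local Open Scope ring_scope.
Implicit Types A B : 'I_m -> 'M[C]_N.

(** The matrix [sum_j A_j (x) E_jj]. *)
Definition block_diag A : 'M[C]_n :=
  \matrix_(p, q) (A (e p).2 (e p).1 (e q).1 *+ ((e p).2 == (e q).2)).

Lemma block_diagM A B : block_diag A *m block_diag B = block_diag (fun j => A j *m B j).
Proof.
apply/matrixP => p q; rewrite !mxE.
transitivity (\sum_i \sum_j (A (e p).2 (e p).1 i *+ ((e p).2 == j)) *
   (B j i (e q).1 *+ (j == (e q).2))).
  rewrite pair_big (reindex e) /=; last exact: onW_bij.
  by apply: eq_bigr => r _; rewrite !mxE.
rewrite -sumrMnl; apply: eq_bigr => i _.
rewrite (bigD1 (e p).2) //= eqxx mulr1n big1 ?addr0 ?mulrnAr // => j /negPf pj.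
by rewrite eq_sym pj mulr0n mul0r.
Qed.

Lemma block_tens_diag (X : 'M[C]_N) (t : 'rV[C]_m) :
  block_tens e X (diag_mx t) = block_diag (fun j => t 0 j *: X).
Proof. by apply/matrixP => p q; rewrite !mxE mulrnAr mulrC. Qed.

Lemma block_diag_unitary A :
  (forall j, A j \is unitarymx) -> block_diag A \is unitarymx.
Proof.
move=> AU; apply/unitarymxP.
have -> : map_mx Num.conj_op (block_diag A)^T =
    block_diag (fun j => map_mx Num.conj_op (A j)^T).
  apply/matrixP => p q; rewrite !mxE eq_sym; case: eqVneq => [->//|_].
  by rewrite !mulr0n rmorph0.
rewrite block_diagM; apply/matrixP => p q; rewrite !mxE.
rewrite -(inj_eq (bij_inj e_bij)) -pair_eqE /pair_eq /= andbC.
case: eqVneq => _; last by rewrite !mulr0n.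
rewrite mulr1n; have /unitarymxP/matrixP/(_ (e p).1 (e q).1) := AU (e p).2.
by rewrite !mxE.
Qed.

End BlockDiag.

Section Realisation.
Variable R : realType.
Local Notation C := R[i].
Variables (a : seq nat) (m : nat).
Hypotheses (a_gt0 : all (fun k => 0 < k)%N a) (m_gt0 : (0 < m)%N).
Local Notation V := (Va R a).
Local Notation N := (tdim a 1).
Local Notation n := (tdim a m).
Local Notation T := (torus R m).
Local Notation b := (@Vform R a).
Local Notation e := (@split_index a m).
Local Notation e_bij := (split_index_bij a m).
Local Notation tens := (utens e_bij).
Local Notation rho := (@Va_lift R a).
Local Notation K := (semidirect (SSp_act R a m)).
Let hV := heisenberg_Va R a_gt0.

Lemma acts_asP g (u : K) :
  (forall v x, g * Fam_elt v x =
     Fam_elt (faut u.2.2 v) (u.1 (faut u.2.2 v) * torus_perm u.2.1 x) * g) ->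
  acts_as g u.
Proof. by move=> gu v x; rewrite conjgE invgK mulgA gu mulgK. Qed.

Lemma acts_as_perm s : exists g, acts_as g ((1, (s, 1)) : K).
Proof.
have PU : perm_mx s \is @unitarymx C m m.
  by apply/unitarymxP; rewrite tr_perm_mx map_perm_mx -perm_mxM mulgV perm_mx1.
exists (PUclass (tens 1 (Unitary PU))); apply: acts_asP => v x /=.
rewrite mul1g; case: (torus_surj x) => t ->; rewrite torus_permE !Fam_eltE.
rewrite -!PUclassM -!utensM mul1g mulg1; congr (PUclass (tens _ _)).
apply/val_inj; rewrite /= mul_mx_diag mul_diag_mx; apply/matrixP => i j.
rewrite !mxE ffunE mulrC; case: eqVneq => [->//|_].
by rewrite !mulr0.
Qed.

Lemma acts_as_aut al : exists g, acts_as g ((1, (1, al)) : K).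
Proof.
have [U UP] := intertwiner hV (fautM al) (faut_form al).
exists (PUclass (tens U 1)); apply: acts_asP => v x /=.
rewrite mul1g torus_perm1; case: (torus_surj x) => t ->; rewrite !Fam_eltE.
rewrite -!PUclassM -!utensM mul1g mulg1.
by apply: utens_class => //; exact: UP.
Qed.

(** [T] is identified with the elements of [U(1)^m] whose first coordinate is [1], so
    homomorphisms into [T] lift to families of characters. *)
Definition coord_ratio (j : 'I_m) (x : T) : circle R :=
  (repr x (Ordinal m_gt0))^-1 * repr x j.

Lemma coord_ratioE j t : coord_ratio j (torus_class t) = (t (Ordinal m_gt0))^-1 * t j.
Proof.
rewrite /coord_ratio; set f := repr _.
have /eq_quotgP/asboolP[z /ffunP fz] : torus_class f = torus_class t.
  by rewrite /torus_class reprK.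
have ft i : t i = f i * z by have := fz i; rewrite !ffunE => <-; rewrite mulVKg.
by rewrite !ft (mulgC _ z) [f j * z]mulgC invgM -mulgA mulKg.
Qed.

Lemma coord_ratioM j : {morph coord_ratio j : x y / x * y}.
Proof.
move=> x y; case: (torus_surj x) (torus_surj y) => s -> [t ->].
rewrite -torus_classM !coord_ratioE !ffunE; apply/val_inj => /=.
by rewrite invfM mulrACA.
Qed.

Lemma coord_ratioK x : torus_class [ffun j => coord_ratio j x] = x.
Proof.
case: (torus_surj x) => t ->; apply/eq_quotgP/asboolP; exists (t (Ordinal m_gt0)).
apply/ffunP => j; rewrite !ffunE coord_ratioE invgM invgK.
by rewrite mulgC mulgA mulgV mul1g.
Qed.

(** With [b (w j) v] the [j]-th coordinate of [phi v], moving [rho (w j)] past [rho v]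
    multiplies the [j]-th block by that coordinate. *)
Lemma acts_as_hom phi : exists g, acts_as g ((phi, (1, 1)) : K).
Proof.
have /choice[w wP] : forall j, exists w, forall v, coord_ratio j (phi v) = b w v.
  move=> j; apply: (heis_dual hV (chi := fun v => coord_ratio j (phi v))) => x y.
  by rewrite gmulfM coord_ratioM.
pose G : unitary R n := Unitary (block_diag_unitary e_bij (fun j => umxP (rho (w j)))).
exists (PUclass G); apply: acts_asP => v x /=.
rewrite torus_perm1; case: (torus_surj x) => t ->.
rewrite -[phi v]coord_ratioK; set r := [ffun j => _].
rewrite -torus_classM !Fam_eltE -!PUclassM; congr PUclass; apply/val_inj.
rewrite /= !block_tens_diag !(block_diagM e_bij).
congr (block_diag _ _); apply/funext => j.
have /(congr1 (@umx _ _)) := heis_comm hV (w j) v; rewrite /= mul_scalar_mx => wv.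
by rewrite -scalemxAr -scalemxAl wv scalerA !mxE !ffunE -wP /= mulrC.
Qed.

Lemma acts_as_surj (u : K) : exists g, acts_as g u.
Proof.
case: u => phi [s al].
have [g gphi] := acts_as_hom phi; have [h hs] := acts_as_perm s.
have [k kal] := acts_as_aut al; exists (g * (h * k)).
pose u1 : K := (phi, (1, 1)); pose u2 : K := (1, (s, 1)); pose u3 : K := (1, (1, al)).
have -> : (phi, (s, al)) = u1 * (u2 * u3).
  have mulE (x y : K) : x * y = (x.1 * SSp_act R a m x.2 y.1, x.2 * y.2) by [].
  rewrite !mulE /=; congr (_, (_, _)).
  - by apply: homP => v; rewrite /= !torus_perm1 !torus_perm_one !mulg1.
  - by rewrite /= mulg1 mul1g.
  - by rewrite -[RHS]/(1 * (1 * al)) !mul1g.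
exact: acts_asM gphi (acts_asM hs kal).
Qed.

End Realisation.

Theorem proposition2p2 (R : realType) (a : seq nat) (m : nat) :
  all (fun k => 0 < k) a ->
  sorted (fun k l => l %| k) a ->
  0 < m ->
  isomorphic (weyl (Fam R a m))
    (semidirect (SSp_act R a m)).
Proof.
move=> a_gt0 _ m_gt0; apply: (@weyl_isomorphic _ _ _ (@acts_as R a m)).
- exact: acts_as_norm.
- exact: acts_as_total.
- exact: acts_as_surj.
- exact: acts_as_uniq.
- exact: acts_asM.
- exact: acts_as1.
Qed.
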